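(* Let $H$ be a (contractive) Hilbert $A$-module of finite rank, with canonical operators $T_1,\dots,T_d$ and defect operator $\Delta$. For $z\in\mathbb C^d$ put $T(z)=\bar z_1T_1+\dots+\bar z_dT_d$, and for $z\in B_d$ let $F(z)$ be the positive operator on the finite-dimensional Hilbert space $\Delta H$ given by $$F(z)\xi=\Delta(\mathbf 1-T(z)^* )^{-1}(\mathbf 1-T(z))^{-1}\Delta\xi,\qquad \xi\in\Delta H.$$ Then for $\sigma$-almost every $\zeta\in\partial B_d$ the limit $$K_0(\zeta)=\lim_{r\uparrow1}(1-r^2)\,\mathrm{trace}\,F(r\zeta)$$ exists and satisfies $0\le K_0(\zeta)\le\mathrm{rank}(H)$.
   Context: Let $d\ge1$ be an integer, $A=\mathbb C[z_1,\dots,z_d]$, $B_d=\{z\in\mathbb C^d:|z|<1\}$ the open unit ball, $\partial B_d$ the unit sphere, and $\sigma$ the normalized surface measure on $\partial B_d$. A (contractive) Hilbert $A$-module is a complex Hilbert space $H$ with commuting bounded operators $T_1,\dots,T_d$ (its canonical operators) satisfying $\|T_1\xi_1+\dots+T_d\xi_d\|^2\le\|\xi_1\|^2+\dots+\|\xi_d\|^2$ for all $\xi_k\in H$, made into an $A$-module by $f\cdot\xi=f(T_1,\dots,T_d)\xi$. Its defect operator is $\Delta=(\mathbf 1-T_1T_1^*-\dots-T_dT_d^* )^{1/2}$ and $\mathrm{rank}(H)$ is the dimension of the (closure of the) range of $\Delta$. Since $\|T(z)\|\le|z|$, the operator $\mathbf 1-T(z)$ is invertible for $z\in B_d$. *)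

(* Defs.v *)
From HB Require Import structures.
From mathcomp Require Import all_boot all_order all_algebra.
From mathcomp Require Import all_classical all_reals all_analysis.
From mathcomp Require Import lra measurable_realfun complex sesquilinear.

Set Implicit Arguments.
Unset Strict Implicit.
Unset Printing Implicit Defensive.

Import Order.TTheory GRing.Theory Num.Theory.
Import numFieldNormedType.Exports.
Local Open Scope classical_set_scope.
Local Open Scope ring_scope.
Local Open Scope complex_scope.

(** The complex numbers are [R[i]] for [R : realType].  In the order of [R[i]],
    [x <= y] means that [y - x] is real and nonnegative. *)

Section power_measure.
Context d (T : measurableType d) (R : realType).

Definition tcons n (x : T * n.-tuple T) : n.+1.-tuple T := [tuple of x.1 :: x.2].

Lemma measurable_tcons n : measurable_fun setT (@tcons n).
Proof. by apply: measurable_cons. Qed.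

Lemma tnth_tcons0 n (x : T * n.-tuple T) : tnth (tcons x) ord0 = x.1.
Proof. exact: tnth0. Qed.

Lemma tnth_tconsS n (x : T * n.-tuple T) k : tnth (tcons x) (lift ord0 k) = tnth x.2 k.
Proof. by rewrite !(tnth_nth x.1). Qed.

Lemma tuple_tcons n (t : n.+1.-tuple T) : tcons (thead t, [tuple of behead t]) = t.
Proof. exact/esym/tuple_eta. Qed.

Section step.
Variables (n : nat) (m : {sigma_finite_measure set T -> \bar R}).
Variable mn : {sigma_finite_measure set (n.-tuple T) -> \bar R}.

(* The canonical sigma-finite structure of [m \x mn] is only found when [m] and
   [mn] are subprobabilities, hence the explicit instances here and for
   [lebesgue_plane]. *)
Definition power_step : set (n.+1.-tuple T) -> \bar R :=
  pushforward (m \x mn)%E (@tcons n).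

HB.instance Definition _ := Measure.copy power_step
  (measure_function_pushforward__canonical__measure_function_Measure
     (m \x mn)%E (@measurable_tcons n)).

Let power_step_sigma_finite : sigma_finite setT power_step.
Proof.
have [F TF Foo] := lebesgue_integral_fubini.product_measure_sigma_finite_subproof m mn.
pose g (t : n.+1.-tuple T) : T * n.-tuple T := (thead t, [tuple of behead t]).
have mg : measurable_fun setT g.
  apply/measurable_fun_pairP; split; first exact: measurable_tnth.
  exact: measurable_behead.
have gK x : g (tcons x) = x.
  case: x => x t; rewrite /g /tcons /= theadE; congr pair; exact/val_inj.
exists (fun k => g @^-1` F k).
  by rewrite -preimage_bigcup -TF preimage_setT.
move=> k; have [mF Fk] := Foo k; split.
  by rewrite -[X in measurable X]setTI; exact: mg.
rewrite /power_step /pushforward (_ : _ @^-1` _ = F k) //.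
by apply/seteqP; split=> x /=; rewrite gK.
Qed.

HB.instance Definition _ := Measure_isSigmaFinite.Build _ _ _ power_step
  power_step_sigma_finite.

End step.

Fixpoint power_measure (m : {sigma_finite_measure set T -> \bar R}) (n : nat) :
    {sigma_finite_measure set (n.-tuple T) -> \bar R} :=
  match n with
  | 0 => \d_([tuple] : 0.-tuple T)
  | n'.+1 => power_step m (power_measure m n')
  end.

End power_measure.

Section complex_space.
Context (R : realType).

(** C is identified with R^2, so that z in C^d carries the product
    sigma-algebra, which is the Borel one. *)
Definition Cn (d : nat) := d.-tuple (measurableTypeR R * measurableTypeR R)%type.

Definition zcoord d (z : Cn d) (k : 'I_d) : R[i] := (tnth z k).1 +i* (tnth z k).2.

Definition rscale d (r : R) (z : Cn d) : Cn d :=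
  [tuple (r * (tnth z k).1, r * (tnth z k).2) | k < d].

Definition cnorm d (z : Cn d) : R :=
  Num.sqrt (\sum_(k < d) ((tnth z k).1 ^+ 2 + (tnth z k).2 ^+ 2)).

Definition unit_ball d : set (Cn d) := [set z | cnorm z < 1].
Definition unit_sphere d : set (Cn d) := [set z | cnorm z = 1].

Definition lebesgue_plane : set (measurableTypeR R * measurableTypeR R) -> \bar R :=
  (@lebesgue_measure R \x @lebesgue_measure R)%E.

HB.instance Definition _ := Measure.on lebesgue_plane.
HB.instance Definition _ := Measure_isSigmaFinite.Build _ _ _ lebesgue_plane
  (lebesgue_integral_fubini.product_measure_sigma_finite_subproof (@lebesgue_measure R) (@lebesgue_measure R)).

Definition volume d : {sigma_finite_measure set (Cn d) -> \bar R} :=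
  power_measure lebesgue_plane d.

Lemma measurable_cnorm d : measurable_fun setT (@cnorm d : Cn d -> measurableTypeR R).
Proof.
apply: (@measurableT_comp _ _ _ _ _ _ (@Num.sqrt R)).
  by apply: continuous_measurable_fun; exact: sqrt_continuous.
apply: measurable_sum => k; apply: measurable_funD; apply: measurable_funX.
  by apply: measurableT_comp; last exact: measurable_tnth.
by apply: measurableT_comp; last exact: measurable_tnth.
Qed.

Lemma measurable_unit_ball d : measurable (@unit_ball d).
Proof.
rewrite (_ : @unit_ball d = @cnorm d @^-1` `]-oo, 1[%classic).
  by rewrite -[X in measurable X]setTI; exact: measurable_cnorm.
by apply/seteqP; split=> z /=; rewrite in_itv.
Qed.

Definition radial d (z : Cn d) : Cn d := rscale (cnorm z)^-1 z.

Lemma measurable_radial d : measurable_fun setT (@radial d).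
Proof.
have minv : measurable_fun setT (GRing.inv : measurableTypeR R -> measurableTypeR R).
  rewrite -(setUv [set (0 : R)]).
  apply/measurable_funU; [exact: measurable_set1 | | split].
    by apply: measurableC; exact: measurable_set1.
  - exact: measurable_fun_set1.
  - apply: open_continuous_measurable_fun.
      rewrite (_ : ~` _ = [set x | x != 0]); first exact: open_neq.
      by apply/seteqP; split=> x /eqP.
    by move=> x; rewrite inE/= => x0; apply: inv_continuous; apply/eqP.
apply/measurable_fun_tnthP => k.
rewrite (_ : _ \o _ = fun z => ((cnorm z)^-1 * (tnth z k).1, (cnorm z)^-1 * (tnth z k).2)).
  have mV : measurable_fun setT (fun z : Cn d => (cnorm z)^-1 : measurableTypeR R).
    by apply: measurableT_comp minv _; exact: measurable_cnorm.
  apply: measurable_fun_pair; apply: measurable_funM => //.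
    by apply: measurableT_comp; last exact: measurable_tnth.
  by apply: measurableT_comp; last exact: measurable_tnth.
by apply/funext => z /=; rewrite tnth_mktuple.
Qed.

Let cube d (a : R) : set (Cn d) :=
  [set z | forall k, (tnth z k).1 \in `[- a, a] /\ (tnth z k).2 \in `[- a, a]].

Let volume_cube d a : 0 <= a ->
  measurable (@cube d a) /\ volume d (@cube d a) = (((a *+ 2) ^+ 2) ^+ d)%:E.
Proof.
move=> a0; pose I : set (measurableTypeR R) := `[- a, a]%classic.
have mI1 : measurable I by exact: measurable_itv.
have lI : lebesgue_measure I = (a *+ 2)%:E.
  rewrite /I lebesgue_measure_itv /= lte_fin; case: ltP => [_|aN].
    by rewrite ?EFinN ?oppeK ?opprK -EFinD ?opprK mulr2n.
  suff -> : a = 0 by rewrite mul0rn.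
  by apply/eqP; rewrite eq_le a0 andbT; lra.
have mI : measurable (I `*` I) by exact: measurableX.
have lII : lebesgue_plane (I `*` I) = ((a *+ 2) ^+ 2)%:E.
  by rewrite /lebesgue_plane product_measure1E // expr2 EFinM -lI.
elim: d => [|d [mc IH]].
  rewrite (_ : @cube 0 a = setT); last by apply/seteqP; split=> // z _ [].
  by split => //; rewrite /volume /= diracT expr0.
have cE : @tcons _ _ d @^-1` @cube d.+1 a = (I `*` I) `*` @cube d a.
  apply/seteqP; split=> [[x t] /= h|[x t] /= [[h1 h2] h] k].
    split; first by have [] := h ord0; rewrite !tnth_tcons0.
    by move=> k; have := h (lift ord0 k); rewrite !tnth_tconsS.
  by case: (unliftP ord0 k) => [j ->|->]; rewrite ?tnth_tconsS // !tnth_tcons0.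
split.
  pose g (t : Cn d.+1) := (thead t, [tuple of behead t] : Cn d).
  have mg : measurable_fun setT g.
    apply/measurable_fun_pairP; split; first exact: measurable_tnth.
    exact: measurable_behead.
  rewrite (_ : @cube d.+1 a = g @^-1` ((I `*` I) `*` @cube d a)).
    by rewrite -[X in measurable X]setTI; apply: mg => //; exact: measurableX.
  by rewrite -cE; apply/seteqP; split=> t; rewrite /= tuple_tcons.
rewrite /volume /= /power_step /pushforward cE product_measure1E //.
by rewrite exprS EFinM -IH -lII.
Qed.

Let sqr_le_cnorm d (z : Cn d) k :
  (tnth z k).1 ^+ 2 + (tnth z k).2 ^+ 2 <= cnorm z ^+ 2.
Proof.
have s0 j : 0 <= (tnth z j).1 ^+ 2 + (tnth z j).2 ^+ 2.
  by rewrite addr_ge0 // sqr_ge0.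
rewrite /cnorm sqr_sqrtr; last exact: sumr_ge0.
by rewrite (bigD1 k) //= lerDl sumr_ge0.
Qed.

Let cnorm_ge0 d (z : Cn d) : 0 <= cnorm z. Proof. exact: sqrtr_ge0. Qed.

Lemma volume_unit_ball d : (0 < volume d (@unit_ball d) < +oo)%E.
Proof.
have [mc1 v1] := @volume_cube d 1 ler01.
pose a : R := (d.*2.+1)%:R^-1.
have a_gt0 : 0 < a by rewrite invr_gt0.
have [mca va] := @volume_cube d a (ltW a_gt0).
have sub1 : @unit_ball d `<=` @cube d 1.
  move=> z /= z1 k; have := sqr_le_cnorm z k; rewrite !in_itv /=.
  have := cnorm_ge0 z; set n := cnorm z in z1 *.
  move: (tnth z k).1 (tnth z k).2 => x y n0 xy.
  have n21 : n ^+ 2 <= 1 by rewrite expr_le1 // ltW.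
  rewrite -!ler_norml.
  split; rewrite -(@ler_pXn2r _ 2) ?nnegrE // expr1n real_normK ?num_real //.
    by have := sqr_ge0 y; lra.
  by have := sqr_ge0 x; lra.
have suba : @cube d a `<=` @unit_ball d.
  move=> z /= za; rewrite /unit_ball /= -(@ltr_pXn2r _ 2) ?nnegrE // expr1n.
  rewrite /cnorm sqr_sqrtr; last first.
    by apply: sumr_ge0 => k _; rewrite addr_ge0 // ?sqr_ge0.
  apply: (@le_lt_trans _ _ (\sum_(k < d) (a ^+ 2 *+ 2))).
    apply: ler_sum => k _; rewrite mulr2n; have [] := za k.
    rewrite !in_itv /= -!ler_norml => h1 h2.
    apply: lerD; rewrite -[leLHS]real_normK ?num_real //;
      by rewrite ler_pXn2r ?nnegrE // ltW.
  rewrite sumr_const card_ord -mulrnA mul2n -mulr_natl expr2 mulrA.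
  have -> : d.*2%:R * a = 1 - a.
    have an0 : (d.*2.+1)%:R * a = 1 by rewrite mulfV // pnatr_eq0.
    by rewrite -[in RHS]an0 -natr1 mulrDl mul1r addrK.
  have a1 : a <= 1 by rewrite invf_le1 ?ler1n.
  nra.
apply/andP; split.
  apply: (@lt_le_trans _ _ (volume d (@cube d a))).
    by rewrite va lte_fin !exprn_gt0 // pmulrn_lgt0.
  by apply: le_measure => //; rewrite inE //; exact: measurable_unit_ball.
apply: (@le_lt_trans _ _ (volume d (@cube d 1))); last by rewrite v1 ltry.
by apply: le_measure => //; rewrite inE //; exact: measurable_unit_ball.
Qed.

Definition ball_weight d : R := (fine (volume d (@unit_ball d)))^-1.

Lemma ball_weight_ge0 d : 0 <= ball_weight d.
Proof. by rewrite invr_ge0 fine_ge0 // measure_ge0. Qed.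

Definition cone_measure d : set (Cn d) -> \bar R :=
  pushforward (mrestr (volume d) (@measurable_unit_ball d)) (@radial d).

HB.instance Definition _ d := Measure.copy (@cone_measure d)
  (measure_function_pushforward__canonical__measure_function_Measure
     (mrestr (volume d) (@measurable_unit_ball d)) (@measurable_radial d)).

(** The normalized surface measure as the cone measure: the image of normalized
    volume on the ball under z |-> z / |z|.  It is a measure on C^d carried by
    the unit sphere, see [sphere_measureT] and [sphere_measure_sphere]. *)
Definition sphere_measure d : set (Cn d) -> \bar R :=
  mscale (NngNum (ball_weight_ge0 d)) (@cone_measure d).

HB.instance Definition _ d := Measure.on (@sphere_measure d).

Lemma sphere_measureT d : sphere_measure [set: Cn d] = 1%E.
Proof.
rewrite /sphere_measure /mscale /= /cone_measure /pushforward /mrestr.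
rewrite preimage_setT setTI /ball_weight.
have /andP[v0 voo] := volume_unit_ball d.
have vfin : volume d (@unit_ball d) \is a fin_num by rewrite ge0_fin_numE // ltW.
rewrite -[X in (_ * X)%E](fineK vfin) -EFinM mulVf //.
by rewrite gt_eqF // fine_gt0 // v0.
Qed.

Lemma sphere_measure_sphere d : (0 < d)%N ->
  sphere_measure (~` @unit_sphere d) = 0%E.
Proof.
move=> d0; rewrite /sphere_measure /mscale /= /cone_measure /pushforward /mrestr.
apply/eqP; rewrite mule_eq0; apply/orP; right.
have [mc vc] := @volume_cube d 0 (lexx _).
rewrite eq_le measure_ge0 andbT.
have <- : volume d (@cube d 0) = 0%E.
  by rewrite vc mul0rn expr0n /= expr0n gtn_eqF.
have msph : measurable (@unit_sphere d).
  rewrite (_ : @unit_sphere d = @cnorm d @^-1` [set 1]) //.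
  rewrite -[X in measurable X]setTI; exact: measurable_cnorm.
apply: le_measure; rewrite ?inE //.
  apply: measurableI; last exact: measurable_unit_ball.
  rewrite -[X in measurable X]setTI; apply: measurable_radial => //.
  exact: measurableC.
move=> z /= [zN _]; have [z0|z0] := eqVneq (cnorm z) 0.
  move=> k; have := sqr_le_cnorm z k; rewrite z0 expr0n /= => h.
  have := sqr_ge0 (tnth z k).1; have := sqr_ge0 (tnth z k).2 => h2 h1.
  rewrite !in_itv /= oppr0 -!eq_le ![0 == _]eq_sym.
  by rewrite -(sqrf_eq0 (tnth z k).1) -(sqrf_eq0 (tnth z k).2); split; apply/eqP; lra.
case: zN; rewrite /unit_sphere /= /cnorm /radial.
under eq_bigr => k _ do rewrite /rscale tnth_mktuple /= !exprMn -mulrDr.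
rewrite -mulr_sumr sqrtrM ?sqr_ge0 // sqrtr_sqr ger0_norm ?invr_ge0 //.
exact: mulVf.
Qed.

End complex_space.

(* [hdot] is linear in its first argument. *)
HB.mixin Record isHilbert (R : realType) H of CompleteNormedModule R[i] H := {
  hdot : {dot H for Num.conj} ;
  hdotE : forall x : H, hdot x x = `|x| ^+ 2 }.

#[short(type="hilbertType")]
HB.structure Definition Hilbert (R : realType) :=
  {H of CompleteNormedModule R[i] H & isHilbert R H}.

Section operators.
Context (R : realType) (H : hilbertType R).
Local Notation "''[' x , y ]" := (hdot x y) : ring_scope.

(** The vector [z] below is unique, and exists when [T] is bounded linear.  The
    value [0] given by [xget] otherwise is never used; likewise for the other
    definitions by [xget]. *)
Definition adjoint (T : H -> H) (y : H) : H :=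
  xget 0 [set z | forall x, '[T x, y] = '[x, z]].

Definition positive_op (T : H -> H) : Prop :=
  [/\ linear T, continuous T & forall x, 0 <= '[T x, x]].

(** The positive square root of a positive operator. *)
Definition op_sqrt (T : H -> H) : H -> H :=
  xget (cst 0) [set S | positive_op S /\ S \o S = T].

Definition orthonormal_basis n (V : set H) (e : 'I_n -> H) : Prop :=
  [/\ forall i, V (e i),
      forall i j, '[e i, e j] = (i == j)%:R &
      forall x, V x -> x = \sum_i '[x, e i] *: e i].

(** The Hilbert space dimension of [V], which is finite here. *)
Definition has_dimension (V : set H) (n : nat) : Prop :=
  exists e : 'I_n -> H, orthonormal_basis V e.

Definition dimension (V : set H) : nat := xget 0 [set n | has_dimension V n].

(** The trace of an operator of a finite-dimensional subspace [V]; it does not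
    depend on the orthonormal basis. *)
Definition trace (V : set H) (F : H -> H) : R[i] :=
  xget 0 [set t | exists n (e : 'I_n -> H),
    orthonormal_basis V e /\ t = \sum_i '[F (e i), e i]].

End operators.

Record hilbert_module (R : realType) (d : nat) (H : hilbertType R) := HilbertModule {
  op : 'I_d -> {linear H -> H};
  (* for a linear map, continuity is boundedness: [linear_bounded_continuous] *)
  op_bounded : forall k, continuous (op k);
  op_commute : forall j k x, op j (op k x) = op k (op j x);
  op_contractive : forall xi : 'I_d -> H,
    `|\sum_(k < d) op k (xi k)| ^+ 2 <= \sum_(k < d) `|xi k| ^+ 2 }.

Section hilbert_module.
Context (R : realType) (d : nat) (H : hilbertType R) (M : hilbert_module d H).

Definition defect : H -> H :=
  op_sqrt (fun x => x - \sum_(k < d) op M k (adjoint (op M k) x)).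

(** A finite-dimensional range is closed, so for a module of finite rank the
    closure is the range itself. *)
Definition defect_space : set H := closure (range defect).

Definition finite_rank : Prop := exists n, has_dimension defect_space n.

Definition rank : nat := dimension defect_space.

Definition op_at (z : Cn R d) (x : H) : H :=
  \sum_(k < d) Num.conj (zcoord z k) *: op M k x.

(** [F(z)] on the defect space; [pinv setT f] is the inverse of the bijection
    [f]. *)
Definition F_op (z : Cn R d) (x : H) : H :=
  defect (pinv setT (fun y => y - adjoint (op_at z) y)
    (pinv setT (fun y => y - op_at z y) (defect x))).

Definition curvature_fun (z : Cn R d) (r : R) : R[i]^o :=
  (1 - r ^+ 2)%:C * trace defect_space (F_op (rscale r z)).

Definition K0 (z : Cn R d) : R[i]^o := lim (curvature_fun z r @[r --> 1^'-]).

End hilbert_module.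

(* Main.v *)
Require Import Defs.
From HB Require Import structures.
From mathcomp Require Import all_boot all_order all_algebra.
From mathcomp Require Import all_classical all_reals all_analysis.
From mathcomp Require Import measurable_realfun complex sesquilinear.
From mathcomp Require Import ring lra.
Import Order.TTheory GRing.Theory Num.Theory.
Import numFieldNormedType.Exports.
Local Open Scope classical_set_scope.
Local Open Scope ring_scope.
Local Open Scope complex_scope.

Set Implicit Arguments.
Unset Strict Implicit.
Unset Printing Implicit Defensive.

(** Fix [zeta] on the sphere and put [S = T(zeta)].  The row operator [W = (Delta, S)] on
    [H + H] is a contraction, since [Delta^2 + sum_k T_k T_k^* = 1], so
    [q(p) = |p|^2 - |W p|^2] is a positive semidefinite form.  For a unit vector [xi] of
    the defect space, the map
      [phi(l) = (xi, conj(l) (1 - conj(l) S)^-1 Delta xi)]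
    on the unit disc satisfies [W phi(l) = (1 - conj(l) S)^-1 Delta xi], hence
      [q(phi(l)) = 1 - (1 - |l|^2) |(1 - conj(l) S)^-1 Delta xi|^2].
    Positivity of [q] gives the bound by the rank after summation over an orthonormal
    basis.  The coefficients of the power series [phi] have square-summable [q]-norms (the
    sum telescopes), so [phi] is a Hardy space function with values in a semi-inner product
    space and has radial limits at almost every point of the circle: this is Fatou's
    theorem, proved here from the Poisson kernel and the Hardy-Littlewood maximal
    inequality.  So the limit exists almost everywhere on each circle
    [{exp(i th) zeta}], and Fubini's theorem together with the invariance of null sets
    under rotations gives the statement almost everywhere on the sphere. *)

(** * The Poisson kernel *)

(** The form [q] may be degenerate and the space need not be complete for it. Hence no boundary
    function and no vector-valued integral appear: every integral is that of a continuous real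
    function built from trigonometric polynomials, and Fatou's theorem only asserts that [B phi phi]
    has a limit along the radius. That suffices, since the energy is a constant minus this number.

    Angles stay in [[-1, 1]]. There the cosine is positive, so a rotation splits into two shears,
    and the window [[-2 pi, 2 pi]] contains [[th - pi, th + pi]], so the maximal function of a
    restricted function sees every interval that the Poisson kernel meets. A short arc is enough,
    since the Fubini argument needs a single good rotation.

    Fubini also asks for a measurable exceptional set, while a limit over all radii is an
    uncountable condition. Continuity in the radius reduces it to rational radii, and composition
    with [radial] extends the energy to all of C^d, where volume replaces surface measure. *)

Section calculus.
Context {R : realType}.
Local Notation mu := (@lebesgue_measure R).

Lemma continuous_integrable_cc (f : R -> R) a b :
  continuous f -> mu.-integrable `[a, b] (EFin \o f).
Proof.
move=> cf; apply: (@continuous_compact_integrable R f); first exact: segment_compact.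
exact: continuous_subspaceT.
Qed.

Lemma continuous_funD (f g : R -> R) : continuous f -> continuous g -> continuous (fun t => f t + g t).
Proof. by move=> cf cg t; apply: cvgD; [exact: cf|exact: cg]. Qed.

Lemma continuous_funB (f g : R -> R) : continuous f -> continuous g -> continuous (fun t => f t - g t).
Proof. by move=> cf cg t; apply: cvgB; [exact: cf|exact: cg]. Qed.

Lemma continuous_funM (f g : R -> R) : continuous f -> continuous g -> continuous (fun t => f t * g t).
Proof. by move=> cf cg t; apply: cvgM; [exact: cf|exact: cg]. Qed.

Lemma continuous_funZ k (f : R -> R) : continuous f -> continuous (fun t => k * f t).
Proof. by move=> cf t; apply: cvgM; [exact: cvg_cst|exact: cf]. Qed.

Lemma continuous_fun_cst (k : R) : continuous (fun _ : R => k).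
Proof. by move=> t; exact: cst_continuous. Qed.

Lemma RintegralZc (f : R -> R) a b k : continuous f ->
  \int[mu]_(t in `[a, b]) (k * f t) = k * \int[mu]_(t in `[a, b]) f t.
Proof. by move=> cf; rewrite RintegralZl //; exact: continuous_integrable_cc. Qed.

Lemma RintegralDc (f g : R -> R) a b : continuous f -> continuous g ->
  \int[mu]_(t in `[a, b]) (f t + g t) =
  \int[mu]_(t in `[a, b]) f t + \int[mu]_(t in `[a, b]) g t.
Proof. by move=> cf cg; rewrite RintegralD //; exact: continuous_integrable_cc. Qed.

Lemma Rintegral_FTC (F f : R -> R) (a b : R) : a < b ->
  (forall x : R, a <= x <= b -> is_derive x (1 : R) F (f x)) -> continuous f ->
  \int[mu]_(x in `[a, b]) f x = F b - F a.
Proof.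
move=> ab dF cf.
have cF x : a <= x <= b -> {for x, continuous F}.
  move=> xab; apply/differentiable_continuous/derivable1_diffP.
  by have ? := dF x xab; exact: ex_derive.
rewrite /Rintegral (@continuous_FTC2 _ f F) //.
- exact: continuous_subspaceT.
- split.
  + move=> x; rewrite in_itv/= => /andP[/ltW ax /ltW xb].
    have ? : is_derive x (1 : R) F (f x) by apply: dF; rewrite ax xb.
    exact: ex_derive.
  + by apply: cvg_at_right_filter; apply: cF; rewrite lexx ltW.
  + by apply: cvg_at_left_filter; apply: cF; rewrite lexx ltW.
- move=> x; rewrite in_itv/= => /andP[/ltW ax /ltW xb].
  have ? : is_derive x (1 : R) F (f x) by apply: dF; rewrite ax xb.
  by rewrite derive1E; exact: derive_val.
Qed.

Lemma primitive_on (f : R -> R) (a b : R) : a < b -> continuous f ->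
  exists F : R -> R, forall x : R, a < x < b -> is_derive x (1 : R) F (f x).
Proof.
move=> ab cf; exists (fun x => \int[mu]_(t in `[a, x]) f t) => x /andP[ax xb].
have [dF F'] := continuous_FTC1_closed xb (continuous_integrable_cc a b cf) ax (cf x).
by apply: DeriveDef; [exact: dF|rewrite -derive1E; exact: F'].
Qed.

Lemma continuous_cosM (a : R) : continuous (fun t : R => cos (a * t)).
Proof.
move=> t; apply: continuous_comp; last exact: continuous_cos.
by apply: continuousM => //; exact: cst_continuous.
Qed.

Lemma continuous_sinM (a : R) : continuous (fun t : R => sin (a * t)).
Proof.
move=> t; apply: continuous_comp; last exact: continuous_sin.
by apply: continuousM => //; exact: cst_continuous.
Qed.

Lemma is_derive_sinM (a t : R) : is_derive t (1 : R) (fun t => sin (a * t)) (a * cos (a * t)).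
Proof.
have da : is_derive t (1 : R) (fun t => a * t) a.
  have := @is_deriveZ _ _ _ _ a _ _ _ (@is_derive_id R R t 1).
  by rewrite /GRing.scale/= mulr1.
have := @is_derive1_comp _ _ _ t _ _ (is_derive_sin (a * t)) da.
by rewrite mulrC.
Qed.

Definition poisson (r t : R) := (1 - r ^+ 2) / (1 - 2 * r * cos t + r ^+ 2).

Lemma poisson_den_gt0 (r t : R) : 0 <= r < 1 -> 0 < 1 - 2 * r * cos t + r ^+ 2.
Proof.
move=> /andP[r0 r1]; have := cos_le1 t => c1.
have : 0 < (1 - r) ^+ 2 by rewrite exprn_gt0 // subr_gt0.
nra.
Qed.

Lemma poisson_ge0 (r t : R) : 0 <= r < 1 -> 0 <= poisson r t.
Proof.
move=> r01; rewrite divr_ge0 ?(ltW (poisson_den_gt0 _ _)) //.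
by move: r01 => /andP[r0 r1]; rewrite subr_ge0 expr_le1 // ltW.
Qed.

Definition dpoisson (r t : R) :=
  - ((1 - r ^+ 2) * (2 * r * sin t) /
     ((1 - 2 * r * cos t + r ^+ 2) * (1 - 2 * r * cos t + r ^+ 2))).

Lemma is_derive_poisson (r t : R) : 0 <= r < 1 ->
  is_derive t (1 : R) (poisson r) (dpoisson r t).
Proof.
move=> r01; have d0 := poisson_den_gt0 t r01.
have dn : 1 - 2 * r * cos t + r ^+ 2 != 0 by rewrite gt_eqF.
have dd : is_derive t (1 : R) (fun t => 1 - 2 * r * cos t + r ^+ 2) (2 * r * sin t).
  by apply: is_derive_eq; rewrite /GRing.scale/=; ring.
have := @is_deriveZ _ _ _ _ (1 - r ^+ 2) _ _ _
  (@is_deriveV R (fun t => 1 - 2 * r * cos t + r ^+ 2) t _ _ dn dd).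
rewrite /poisson /dpoisson => h; apply: is_derive_eq.
by rewrite /GRing.scale/=; field.
Qed.

Lemma dpoisson_le0 (r t : R) : 0 <= r < 1 -> 0 <= t <= pi -> dpoisson r t <= 0.
Proof.
move=> r01 t0; have d0 := poisson_den_gt0 t r01; move: r01 => /andP[r0 r1].
rewrite oppr_le0 divr_ge0 ?mulr_ge0 ?(ltW d0) ?sin_ge0_pi //.
by rewrite subr_ge0 expr_le1 // ltW.
Qed.

Lemma continuous_poisson (r : R) : 0 <= r < 1 -> continuous (poisson r).
Proof.
move=> r01 t; apply/differentiable_continuous/derivable1_diffP.
by have ? := is_derive_poisson t r01; exact: ex_derive.
Qed.

Local Notation IP f := (\int[mu]_(t in `[0, pi]) f t).

Lemma sin_natpi n : sin (n%:R * pi) = 0 :> R.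
Proof.
elim: n => [|n IH]; first by rewrite mul0r sin0.
by rewrite -natr1 mulrDl mul1r sinDpi IH oppr0.
Qed.

Lemma IP_cosn (n : nat) : IP (fun t => cos (n.+1%:R * t)) = 0.
Proof.
have n0 : n.+1%:R != 0 :> R by rewrite pnatr_eq0.
have -> : IP (fun t => cos (n.+1%:R * t)) =
    IP (fun t => n.+1%:R^-1 * (n.+1%:R * cos (n.+1%:R * t))).
  by apply: eq_Rintegral => t _; rewrite mulKf.
have c : continuous (fun t : R => n.+1%:R * cos (n.+1%:R * t)).
  by move=> t; apply: cvgM; [exact: cvg_cst|exact: continuous_cosM].
rewrite RintegralZl //; last exact: continuous_integrable_cc.
have -> := @Rintegral_FTC (fun t => sin (n.+1%:R * t)) _ 0 pi (pi_gt0 R)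
  (fun x _ => is_derive_sinM _ x) c.
rewrite mulr0 sin0 subr0.
by rewrite sin_natpi mulr0.
Qed.

Lemma IP_cst (c : R) : IP (fun=> c) = c * pi.
Proof.
rewrite Rintegral_cst //=; rewrite lebesgue_measure_itv /= lte_fin pi_gt0 //.
by rewrite oppr0 adde0.
Qed.

Lemma continuous_poisson_cos (r : R) n : 0 <= r < 1 ->
  continuous (fun t => poisson r t * cos (n%:R * t)).
Proof.
by move=> r01 t; apply: cvgM; [exact: continuous_poisson|exact: continuous_cosM].
Qed.

(** Multiplying by the denominator of [poisson r] and using the addition formulas gives a three-term
    recurrence in [n], so the integral is never exchanged with the Fourier series of the kernel. *)
Lemma IP_poisson_cos (r : R) n : 0 <= r < 1 ->
  IP (fun t => poisson r t * cos (n%:R * t)) = pi * r ^+ n.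
Proof.
move=> r01; pose I n := IP (fun t => poisson r t * cos (n%:R * t)).
have intI k : mu.-integrable `[0, pi] (EFin \o (fun t => poisson r t * cos (k%:R * t))).
  by apply: continuous_integrable_cc; exact: continuous_poisson_cos.
have cI k := @continuous_poisson_cos r k r01.
have E k t : (1 + r ^+ 2) * (poisson r t * cos (k.+1%:R * t)) =
   (1 - r ^+ 2) * cos (k.+1%:R * t) +
   (r * (poisson r t * cos (k.+2%:R * t)) + r * (poisson r t * cos (k%:R * t))).
  have -> : k.+2%:R * t = k.+1%:R * t + t by rewrite -[k.+2%:R]natr1 mulrDl mul1r.
  have -> : k%:R * t = k.+1%:R * t - t by rewrite -[k.+1%:R]natr1 mulrDl mul1r addrK.
  rewrite !cosD cosN sinN /poisson; move: (cos (k.+1%:R * t)) (sin (k.+1%:R * t)) => x y.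
  have /lt0r_neq0 := poisson_den_gt0 t r01 => dn.
  by field.
(* The bounded solutions of this recurrence are multiples of [r ^+ k]. *)
have rec k : (1 + r ^+ 2) * I k.+1 = r * I k.+2 + r * I k.
  rewrite /I -RintegralZc //.
  under eq_Rintegral do rewrite E.
  rewrite RintegralDc; [|exact/continuous_funZ/continuous_cosM|]; last first.
    by apply: continuous_funD; exact/continuous_funZ.
  rewrite RintegralZc ?IP_cosn ?mulr0 ?add0r; last exact: continuous_cosM.
  by rewrite RintegralDc; [rewrite !RintegralZc|exact/continuous_funZ|exact/continuous_funZ].
have rec0 : (1 + r ^+ 2) * I 0%N = (1 - r ^+ 2) * pi + 2 * r * I 1%N.
  rewrite /I -RintegralZc // -RintegralZc // -IP_cst -RintegralDc //.
  - apply: eq_Rintegral => t _; rewrite mul0r cos0 mulr1; have -> : 1%:R * t = t :> R by rewrite mul1r.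
    rewrite /poisson.
    have /lt0r_neq0 := poisson_den_gt0 t r01 => dn.
    by field.
  - exact: continuous_fun_cst.
  - exact: continuous_funZ.
(* The characteristic roots are [r] and its inverse. [J] removes the root [r]; what remains would
   grow like the inverse powers of [r], which the bound [Ib] excludes. *)
pose J n := I n.+1 - r * I n.
have Jrec k : J k = r * J k.+1.
  by rewrite /J; have := rec k; nra.
have J0n k : J 0%N = r ^+ k * J k.
  by elim: k => [|k IH]; [rewrite mul1r|rewrite IH exprSr -mulrA -Jrec].
have Ib k : `|I k| <= I 0%N.
  apply: le_trans (le_normr_Rintegral _ (intI _)) _ => //.
  apply: le_Rintegral => //.
    apply: continuous_integrable_cc => t; apply: (@cvg_norm _ R).
    exact: continuous_poisson_cos.
  move=> t _; rewrite normrM mul0r cos0 ger0_norm ?poisson_ge0 //.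
  by apply: ler_wpM2l; [exact: poisson_ge0|rewrite ler_norml cos_geN1 cos_le1].
have J0 : J 0%N = 0.
  apply/eqP; rewrite -normr_eq0; apply/eqP/le_anti; rewrite normr_ge0 andbT.
  have I0 : 0 <= I 0%N by apply: le_trans (normr_ge0 _) (Ib 0%N).
  have c : r ^+ k * (2 * I 0%N) @[k --> \oo] --> 0.
    rewrite -(mul0r (2 * I 0%N)); apply: cvgM; last exact: cvg_cst.
    by apply: cvg_expr; move: r01 => /andP[r0 r1]; rewrite ger0_norm.
  apply: (cvgr_to_ge c); apply: nearW => k; have /andP[r0 /ltW r1] := r01.
  rewrite (J0n k) normrM normrX (ger0_norm r0).
  apply: ler_wpM2l; first by rewrite exprn_ge0.
  rewrite (le_trans (ler_normB _ _)) // mulrDl mul1r lerD //.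
  by rewrite normrM (ger0_norm r0) -[leRHS]mul1r ler_pM.
have Istep k : I k.+1 = r * I k.
  have : J k = 0.
    elim: k => // k; rewrite Jrec => /eqP; rewrite mulf_eq0 => /orP[/eqP r0|/eqP //].
    by rewrite Jrec r0 mul0r.
  by move/eqP; rewrite subr_eq0 => /eqP.
have -> : IP (fun t => poisson r t * cos (n%:R * t)) = r ^+ n * I 0%N.
  by rewrite -/(I n); elim: n => [|n IH]; [rewrite mul1r|rewrite Istep IH mulrA -exprS].
rewrite mulrC; congr (_ * _).
have r21 : 0 < 1 - r ^+ 2 by case/andP: r01 => ? ?; rewrite subr_gt0 expr_lt1.
apply: (@mulfI _ (1 - r ^+ 2)); first by rewrite gt_eqF.
by have := rec0; rewrite Istep; nra.
Qed.

End calculus.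

Section poisson.
Context {R : realType}.
Local Notation mu := (@lebesgue_measure R).
Local Notation IP f := (\int[mu]_(t in `[0, pi]) f t).

(* Integration by parts, using that the Poisson kernel decreases on [0, pi]. *)
Lemma IP_poisson_le (f : R -> R) (th r c : R) : continuous f -> 0 <= r < 1 ->
  (forall s : R, 0 < s <= pi -> \int[mu]_(t in `[th - s, th + s]) f t <= 2 * s * c) ->
  IP (fun t => poisson r t * (f (th + t) + f (th - t))) <= 2 * c * pi.
Proof.
move=> cf r01 fc.
have pi0 := pi_gt0 R.
(* The margin of 1 makes [F] differentiable at the closed end points [th - pi] and [th + pi]. *)
have [F dF] : exists F : R -> R, forall x : R, th - pi - 1 < x < th + pi + 1 ->
    is_derive x (1 : R) F (f x) by apply: primitive_on => //; lra.
pose g t := f (th + t) + f (th - t).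
have cft : continuous (fun t => f (th + t)).
  move=> t; apply: (@continuous_comp _ _ _ (fun t => th + t) f); last exact: cf.
  by apply: cvgD; [exact: cvg_cst|exact: cvg_id].
have cftN : continuous (fun t => f (th - t)).
  move=> t; apply: (@continuous_comp _ _ _ (fun t => th - t) f); last exact: cf.
  by apply: cvgB => //; exact: cvg_cst.
have cg : continuous g by exact: continuous_funD.
have cp := continuous_poisson r01.
(* [D] is the primitive of [2 * c - g] vanishing at 0, and the hypothesis on averages says that it
   is nonnegative. *)
pose D t := 2 * c * t - (F (th + t) - F (th - t)).
have dD t : 0 <= t <= pi -> is_derive t (1 : R) D (2 * c - g t).
  move=> t0.
  have d1 : is_derive t (1 : R) (fun t => F (th + t)) (f (th + t)).
    have dl : is_derive t (1 : R) (fun t : R => th + t) 1.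
      have := @is_deriveD _ _ _ _ _ _ _ _ _ (is_derive_cst th t 1) (is_derive_id t 1).
      by rewrite add0r.
    have dFt : is_derive (th + t) (1 : R) F (f (th + t)) by apply: dF; lra.
    by have := @is_derive1_comp _ F _ t _ _ dFt dl; rewrite mulr1.
  have d2 : is_derive t (1 : R) (fun t => F (th - t)) (- f (th - t)).
    have dl : is_derive t (1 : R) (fun t : R => th - t) (-1).
      have := @is_deriveB _ _ _ _ _ _ _ _ _ (is_derive_cst th t 1) (is_derive_id t 1).
      by rewrite sub0r.
    have dFt : is_derive (th - t) (1 : R) F (f (th - t)) by apply: dF; lra.
    by have := @is_derive1_comp _ F _ t _ _ dFt dl; rewrite mulrN1.
  have d3 := @is_deriveZ _ _ _ _ (2 * c) _ _ _ (@is_derive_id R R t 1).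
  have := @is_deriveB _ _ _ _ _ _ _ _ _ d3 (@is_deriveB _ _ _ _ _ _ _ _ _ d1 d2).
  by rewrite /GRing.scale/= mulr1 opprK.
have D0 : D 0 = 0 by rewrite /D mulr0 addr0 subr0 subrr subr0.
have DE s : 0 < s <= pi -> D s = 2 * s * c - \int[mu]_(t in `[th - s, th + s]) f t.
  move=> s0; have ab : th - s < th + s by lra.
  have dFs x : th - s <= x <= th + s -> is_derive x (1 : R) F (f x).
    by move=> xs; apply: dF; lra.
  by rewrite (Rintegral_FTC ab dFs cf) /D; lra.
have Dge0 s : 0 <= s <= pi -> 0 <= D s.
  move=> /andP[]; rewrite le_eqVlt => /predU1P[<- _|s0 sp]; first by rewrite D0.
  by rewrite DE ?s0 // subr_ge0; apply: fc; rewrite s0.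
have cPD : continuous (fun t => poisson r t * (2 * c - g t)).
  by apply: continuous_funM => //; apply: continuous_funB => //; exact: continuous_fun_cst.
have [H dH] : exists H : R -> R, forall x : R, - 1 < x < pi + 1 ->
    is_derive x (1 : R) H (poisson r x * (2 * c - g x)) by apply: primitive_on => //; lra.
have dE t : 0 <= t <= pi ->
    is_derive t (1 : R) (fun t => H t - poisson r t * D t) (- (dpoisson r t * D t)).
  move=> t0.
  have h1 : is_derive t (1 : R) H (poisson r t * (2 * c - g t)) by apply: dH; lra.
  have h2 := is_derive_poisson t r01.
  have h3 := dD t t0.
  have h4 := @is_deriveB _ _ _ _ _ _ _ _ _ h1 (@is_deriveM _ _ _ _ _ _ _ _ h2 h3).
  by apply: is_derive_eq h4 _; rewrite /GRing.scale/=; ring.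
(* Integration by parts in the form of monotonicity: the derivative of [H - poisson r * D] is
   [- dpoisson r * D], which is nonnegative. *)
have EE : H 0 - poisson r 0 * D 0 <= H pi - poisson r pi * D pi.
  apply: (@ger0_derive1_ndecr R (fun t => H t - poisson r t * D t) 0 pi) => //; last exact: ltW.
  - move=> x; rewrite in_itv/= => /andP[/ltW x0 /ltW xp].
    have ? : is_derive x (1 : R) (fun t => H t - poisson r t * D t) (- (dpoisson r x * D x)).
      by apply: dE; rewrite x0.
    exact: ex_derive.
  - move=> x; rewrite in_itv/= => /andP[/ltW x0 /ltW xp].
    have ? : is_derive x (1 : R) (fun t => H t - poisson r t * D t) (- (dpoisson r x * D x)).
      by apply: dE; rewrite x0.
    rewrite derive1E derive_val oppr_ge0 mulr_le0_ge0 //.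
      by rewrite dpoisson_le0 // x0.
    by rewrite Dge0 // x0.
  - apply: continuous_in_subspaceT => x; rewrite inE/= in_itv/= => xp.
    apply/differentiable_continuous/derivable1_diffP.
    by have ? := dE x xp; exact: ex_derive.
have PD : 0 <= IP (fun t => poisson r t * (2 * c - g t)).
  have dHp x : 0 <= x <= pi -> is_derive x (1 : R) H (poisson r x * (2 * c - g x)).
    by move=> xp; apply: dH; lra.
  rewrite (Rintegral_FTC pi0 dHp cPD).
  move: EE; rewrite D0 mulr0 subr0 => EE.
  have : 0 <= poisson r pi * D pi by rewrite mulr_ge0 ?poisson_ge0 ?Dge0 // lexx ltW.
  lra.
have E2 : IP (fun t => poisson r t) = pi.
  have := @IP_poisson_cos R r 0 r01; rewrite expr0 mulr1; apply: etrans.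
  by apply: eq_Rintegral => t _; rewrite mul0r cos0 mulr1.
have E1 : 2 * c * IP (fun t => poisson r t) =
   IP (fun t => poisson r t * (2 * c - g t)) + IP (fun t => poisson r t * g t).
  rewrite -RintegralZc // -RintegralDc //; last exact: continuous_funM.
  by apply: eq_Rintegral => t _; ring.
by rewrite E2 in E1; rewrite E1 lerDr.
Qed.

End poisson.

(** * Trigonometric integrals and unit complex numbers *)

Section trig.
Context {R : realType}.
Local Notation mu := (@lebesgue_measure R).
Local Notation I4 f := (\int[mu]_(t in `[- (2 * pi), 2 * pi]) f t).

(** The window of two full periods keeps the orthogonality relations and contains
    [[th - pi, th + pi]] whenever [|th| <= 1]. *)
Lemma I4_cosn (n : nat) : I4 (fun t => cos (n.+1%:R * t)) = 0.
Proof.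
have pi0 := pi_gt0 R.
have n0 : n.+1%:R != 0 :> R by rewrite pnatr_eq0.
have -> : I4 (fun t => cos (n.+1%:R * t)) =
    I4 (fun t => n.+1%:R^-1 * (n.+1%:R * cos (n.+1%:R * t))).
  by apply: eq_Rintegral => t _; rewrite mulKf.
have c : continuous (fun t : R => n.+1%:R * cos (n.+1%:R * t)).
  by apply: continuous_funZ; exact: continuous_cosM.
rewrite RintegralZc //.
have ab : - (2 * pi) < 2 * pi :> R by lra.
have -> := @Rintegral_FTC _ (fun t => sin (n.+1%:R * t)) _ _ _ ab
  (fun x _ => is_derive_sinM _ x) c.
by rewrite mulrN sinN mulrA -natrM sin_natpi !oppr0 addr0 mulr0.
Qed.

Lemma is_derive_cosM (a t : R) :
  is_derive t (1 : R) (fun t => cos (a * t)) (- (a * sin (a * t))).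
Proof.
have da : is_derive t (1 : R) (fun t => a * t) a.
  have := @is_deriveZ _ _ _ _ a _ _ _ (@is_derive_id R R t 1).
  by rewrite /GRing.scale/= mulr1.
have := @is_derive1_comp _ _ _ t _ _ (is_derive_cos (a * t)) da.
by rewrite mulNr mulrC.
Qed.

Lemma I4_sinn (n : nat) : I4 (fun t => sin (n.+1%:R * t)) = 0.
Proof.
have pi0 := pi_gt0 R.
have n0 : n.+1%:R != 0 :> R by rewrite pnatr_eq0.
have -> : I4 (fun t => sin (n.+1%:R * t)) =
    I4 (fun t => - n.+1%:R^-1 * (- (n.+1%:R * sin (n.+1%:R * t)))).
  by apply: eq_Rintegral => t _; rewrite mulNr mulrN opprK mulKf.
have c : continuous (fun t : R => - (n.+1%:R * sin (n.+1%:R * t))).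
  move=> t; apply: cvgN; apply: cvgM; first exact: cvg_cst.
  exact: continuous_sinM.
rewrite RintegralZc //.
have ab : - (2 * pi) < 2 * pi :> R by lra.
have -> := @Rintegral_FTC _ (fun t => cos (n.+1%:R * t)) _ _ _ ab
  (fun x _ => is_derive_cosM _ x) c.
by rewrite mulrN cosN subrr mulr0.
Qed.

Lemma I4_cst (c : R) : I4 (fun=> c) = 4 * pi * c.
Proof.
have pi0 := pi_gt0 R.
rewrite Rintegral_cst //= lebesgue_measure_itv /= lte_fin.
rewrite ifT /=; first by lra.
by lra.
Qed.

Definition cis (t : R) : R[i] := cos t +i* sin t.

Lemma cisD a b : cis (a + b) = cis a * cis b.
Proof. by rewrite /cis cosD sinD; simpc; congr (_ +i* _); rewrite addrC [X in _ + X]mulrC. Qed.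

Lemma cis0 : cis 0 = 1.
Proof. by rewrite /cis cos0 sin0. Qed.

Lemma cisE t : cis t = (cos t)%:C + (sin t)%:C * 'i%C.
Proof. by rewrite /cis; simpc. Qed.

Lemma cisDB a b : cis (a + b) + cis (a - b) = (2 * cos b)%:C * cis a.
Proof.
rewrite /cis !cosD !sinD cosN sinN; simpc; congr (_ +i* _); ring.
Qed.

Lemma conj_cis t : Num.conj (cis t) = cis (- t).
Proof. by rewrite /cis cosN sinN. Qed.

End trig.

(** * Radial limits of power series in a semi-inner product space *)

Section left_cauchy.
Context {R : realType}.

(** Tolerances are indexed by natural numbers, so that restricting [r] and [s] to the rationals
    leaves a countable condition. *)
Definition left_cauchy (g : R -> R) := forall k : nat, exists m : nat, forall r s : R,
  1 - m.+1%:R^-1 < r < 1 -> 1 - m.+1%:R^-1 < s < 1 -> `|g r - g s| <= k.+1%:R^-1.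

Lemma left_cauchyP (g : R -> R) : left_cauchy g <-> cvg (g r @[r --> 1^'-]).
Proof.
split=> [gc|/cvg_ex [l /cvgrPdist_le gl] k].
  apply/cauchy_cvgP/cauchyP => e e0.
  have [k ke] := ltr_add_invr (e0).
  have {}ke : k.+1%:R^-1 < e by rewrite add0r in ke.
  have [m mg] := gc k.
  have m0 : 0 < m.+1%:R^-1 :> R by rewrite invr_gt0.
  pose s : R := 1 - m.+1%:R^-1 / 2.
  have sb : 1 - m.+1%:R^-1 < s < 1.
    by rewrite /s; move: (m.+1%:R^-1) m0 => q q0; lra.
  exists (g s).
  have N : \forall r \near (1:R)^'-, 1 - m.+1%:R^-1 < r < 1.
    by near=> r; apply/andP; split; near: r; [apply: nbhs_left_gt; rewrite ltrBlDr ltrDl|exact: nbhs_left_lt].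
  apply: filterS N => r rb /=.
  by rewrite /ball/= (le_lt_trans (mg _ _ sb rb)).
have k0 : 0 < (k.+1%:R^-1 / 2 : R) by rewrite divr_gt0 // invr_gt0.
have [d /= d0 dg] := gl _ k0.
have [m md] := ltr_add_invr d0; rewrite add0r in md.
exists m => r s rb sb.
have h t : 1 - m.+1%:R^-1 < t < 1 -> `|l - g t| <= k.+1%:R^-1 / 2.
  move=> /andP[t1 t2]; apply: dg => //=.
  by rewrite ger0_norm ?subr_ge0 ?(ltW t2) // (lt_trans _ md) // ltrBlDr addrC -ltrBlDr.
rewrite -(subrK l (g r)) -addrA (le_trans (ler_normD _ _)) //.
have := h _ rb; have := h _ sb; rewrite (distrC l (g r)) => h1 h2.
by rewrite (le_trans (lerD h2 h1)) // -splitr.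
Unshelve. all: by end_near. Qed.

End left_cauchy.

Section liminf.
Context {R : realType}.
Local Notation mu := (@lebesgue_measure R).

(** The tail intersections increase with [j] and the one from [j] on lies in [A j], so continuity
    from below applies. It treats exceptional sets that are not nested: a point outside this lower
    limit escapes [A i] for infinitely many [i]. *)
Lemma measure_liminf_le (A : nat -> set R) (m : \bar R) :
  (forall i, measurable (A i)) -> (forall i, (mu (A i) <= m)%E) ->
  measurable (\bigcup_j \bigcap_(i in [set i | (j <= i)%N]) A i) /\
  (mu (\bigcup_j \bigcap_(i in [set i | (j <= i)%N]) A i) <= m)%E.
Proof.
move=> mA Am; pose U j := \bigcap_(i in [set i | (j <= i)%N]) A i.
have mU j : measurable (U j) by apply: bigcap_measurableType.
have mUU : measurable (\bigcup_j U j) by apply: bigcupT_measurable.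
split => //.
have ndU : nondecreasing_seq U.
  move=> i j ij; apply/subsetPset => x Ux k /= jk.
  by apply: Ux => /=; exact: leq_trans jk.
have cU := @nondecreasing_cvg_mu _ _ _ mu _ mU mUU ndU.
suff : (mu (\bigcup_j U j) <= m)%E by [].
apply: (cvge_to_le cU); apply: nearW => j /=; apply: le_trans (Am j).
apply: le_measure; [by rewrite inE; exact: mU|by rewrite inE; exact: mA|].
by move=> x; apply => /=.
Qed.

End liminf.

Section fatou.
Context {R : realType} (V : lmodType R[i]) (B : V -> V -> R).
Local Notation mu := (@lebesgue_measure R).
Local Notation IP f := (\int[mu]_(t in `[0, pi]) f t).
Local Notation I4 f := (\int[mu]_(t in `[- (2 * pi), 2 * pi]) f t).
(** [B] models the real part of a Hermitian semi-inner product: a real bilinear form invariant under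
    unit scalars, possibly degenerate. *)
Hypothesis Bsym : forall u v, B u v = B v u.
Hypothesis BDl : forall u v w, B (u + v) w = B u w + B v w.
Hypothesis BZl : forall (a : R) u v, B (a%:C *: u) v = a * B u v.
Hypothesis Bcis : forall t u v, B (cis t *: u) (cis t *: v) = B u v.
Hypothesis Bge0 : forall u, 0 <= B u u.

Lemma sform0l v : B 0 v = 0.
Proof. by rewrite -(scale0r 0) (BZl 0) mul0r. Qed.

Lemma sformDr u v w : B u (v + w) = B u v + B u w.
Proof. by rewrite Bsym BDl !(Bsym u). Qed.

Lemma sformZr a u v : B u (a%:C *: v) = a * B u v.
Proof. by rewrite Bsym BZl (Bsym u). Qed.

Lemma sformNl u v : B (- u) v = - B u v.
Proof.
have -> : - u = (- 1)%:C *: u by rewrite rmorphN rmorph1 scaleN1r.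
by rewrite BZl mulN1r.
Qed.

Lemma sformNr u v : B u (- v) = - B u v.
Proof. by rewrite Bsym sformNl (Bsym u). Qed.

Lemma form_suml (I : Type) (s : seq I) (P : pred I) (F : I -> V) v :
  B (\sum_(i <- s | P i) F i) v = \sum_(i <- s | P i) B (F i) v.
Proof. by elim/big_rec2: _ => [|i x y _ <-]; rewrite ?sform0l ?BDl. Qed.

(** The imaginary part of the underlying Hermitian form is recovered through [B ('i%C *: u) v]. *)
Lemma form_cis a b u v :
  B (cis a *: u) (cis b *: v) = cos (a - b) * B u v + sin (a - b) * B ('i%C *: u) v.
Proof.
have -> : cis a = cis b * cis (a - b) by rewrite -cisD addrC subrK.
by rewrite -scalerA Bcis cisE scalerDl BDl -scalerA !BZl.
Qed.

Lemma form_sqrD u v : B (u + v) (u + v) = B u u + 2 * B u v + B v v.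
Proof. rewrite BDl !sformDr (Bsym v u); ring. Qed.

Lemma form_sqrB u v : B (u - v) (u - v) = B u u - 2 * B u v + B v v.
Proof. rewrite form_sqrD sformNr !sformNl sformNr; ring. Qed.

Variable v : nat -> V.

(** A block of the power series in the conjugate of [r * cis th]; [r = 1] gives its boundary
    values. *)
Definition pow_sum N K (r th : R) : V :=
  \sum_(N <= n < K) (r ^+ n)%:C *: (cis (- (n%:R * th)) *: v n).

Lemma pow_sum1DB N K th t :
  pow_sum N K 1 (th + t) + pow_sum N K 1 (th - t) =
  \sum_(N <= n < K) (2 * cos (n%:R * t))%:C *: (cis (- (n%:R * th)) *: v n).
Proof.
rewrite /pow_sum -big_split /=; apply: eq_bigr => n _.
rewrite !expr1n !scale1r -scalerDl scalerA -cisDB; congr (_ *: _).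
by rewrite addrC; congr (cis _ + cis _); ring.
Qed.

Definition circ N K t := B (pow_sum N K 1 t) (pow_sum N K 1 t).

Lemma circ_cross N K t :
  B (pow_sum N K 1 t) (cis (- (K%:R * t)) *: v K) =
  \sum_(N <= n < K) (cos ((K%:R - n%:R) * t) * B (v n) (v K)
     + sin ((K%:R - n%:R) * t) * B ('i%C *: v n) (v K)).
Proof.
rewrite /pow_sum form_suml; apply: eq_bigr => n _.
rewrite expr1n scale1r form_cis; congr (cos _ * _ + sin _ * _); ring.
Qed.

(** These are the cross terms in Parseval's identity: each frequency [K - n] is positive, hence
    integrates to zero. Continuity is carried along because additivity of the integral needs it in
    the induction. *)
Lemma trig_sum (s : seq nat) (K : nat) (c d : nat -> R) :
  {in s, forall n, (n < K)%N} ->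
  let f t := \sum_(n <- s) (cos ((K%:R - n%:R) * t) * c n + sin ((K%:R - n%:R) * t) * d n) in
  continuous f /\ I4 f = 0.
Proof.
elim: s => [|n s IH] sK f.
  have -> : f = fun=> 0 by apply/funext => t; rewrite /f big_nil.
  by split; [exact: continuous_fun_cst|rewrite I4_cst mulr0].
have [|cg g0] := IH; first by move=> m ms; apply: sK; rewrite inE ms orbT.
set g := (fun t => _) in cg g0.
have nK : (n < K)%N by apply: sK; rewrite inE eqxx.
have Kn : K%:R - n%:R = (K - n.+1).+1%:R :> R by rewrite -subSn // subSS natrB // ltnW.
have -> : f = fun t => (c n * cos ((K - n.+1).+1%:R * t) + d n * sin ((K - n.+1).+1%:R * t)) + g t.
  by apply/funext => t; rewrite /f big_cons Kn (mulrC (c n)) (mulrC (d n)).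
have cc := @continuous_cosM R (K - n.+1).+1%:R.
have cs := @continuous_sinM R (K - n.+1).+1%:R.
split; first by apply: continuous_funD => //; apply: continuous_funD; exact: continuous_funZ.
rewrite RintegralDc //; last by apply: continuous_funD; exact: continuous_funZ.
rewrite g0 addr0 RintegralDc; [|exact: continuous_funZ|exact: continuous_funZ].
by rewrite !RintegralZc // I4_cosn I4_sinn !mulr0 addr0.
Qed.

(** Parseval's identity, adding one coefficient at a time; [4 * pi] is the length of the window. *)
Lemma circ_int N K : (N <= K)%N ->
  continuous (circ N K) /\ I4 (circ N K) = 4 * pi * \sum_(N <= n < K) B (v n) (v n).
Proof.
move=> /subnKC <-; elim: (K - N)%N => [|j [IHc IHi]].
  have -> : circ N (N + 0) = fun=> 0.
    by apply/funext => t; rewrite /circ /pow_sum addn0 big_geq // sform0l.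
  by split; [exact: continuous_fun_cst|rewrite I4_cst addn0 big_geq].
rewrite addnS; set k := (N + j)%N in IHc IHi *.
have Nk : (N <= k)%N by rewrite leq_addr.
have [|ch h0] := @trig_sum (index_iota N k) k (fun n => B (v n) (v k)) (fun n => B ('i%C *: v n) (v k)).
  by move=> n; rewrite mem_index_iota => /andP[].
set h := (fun t => _) in ch h0.
have -> : circ N k.+1 = fun t => (circ N k t + 2 * h t) + B (v k) (v k).
  apply/funext => t; rewrite /circ {1 2}/pow_sum !big_nat_recr //= -/(pow_sum N k 1 t).
  by rewrite form_sqrD expr1n !scale1r circ_cross Bcis.
split.
  apply: continuous_funD; last exact: continuous_fun_cst.
  by apply: continuous_funD => //; exact: continuous_funZ.
rewrite RintegralDc; [|by apply: continuous_funD => //; exact: continuous_funZ|exact: continuous_fun_cst].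
rewrite RintegralDc //; last exact: continuous_funZ.
rewrite RintegralZc // h0 IHi I4_cst big_nat_recr //=; ring.
Qed.

Lemma sum_IP_poisson N K (r : R) (b : nat -> R) : 0 <= r < 1 ->
  let f t := poisson r t * \sum_(N <= n < K) cos (n%:R * t) * b n in
  continuous f /\ IP f = pi * \sum_(N <= n < K) r ^+ n * b n.
Proof.
move=> r01 f; elim: K @f => [|K IH].
  have E : (fun t => poisson r t * \sum_(N <= n < 0) cos (n%:R * t) * b n) = fun=> 0.
    by apply/funext => t; rewrite big_geq // mulr0.
  by rewrite /= E big_geq // IP_cst mul0r mulr0; split => //; exact: continuous_fun_cst.
case: IH => cf If; set f := (fun t => _) in cf If.
rewrite /=; case: (leqP N K) => NK; last first.
  rewrite big_geq // mulr0.
  have E : (fun t => poisson r t * \sum_(N <= n < K.+1) cos (n%:R * t) * b n) = fun=> 0.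
    by apply/funext => t; rewrite big_geq // mulr0.
  by split; rewrite E; [exact: continuous_fun_cst|rewrite IP_cst mul0r].
have E : (fun t => poisson r t * \sum_(N <= n < K.+1) cos (n%:R * t) * b n) =
    fun t => f t + b K * (poisson r t * cos (K%:R * t)).
  by apply/funext => t; rewrite big_nat_recr //= /f; ring.
have cp := @continuous_poisson_cos R r K r01.
split; rewrite E; first by apply: continuous_funD => //; exact: continuous_funZ.
rewrite RintegralDc //; last exact: continuous_funZ.
rewrite RintegralZc // If IP_poisson_cos // big_nat_recr //=; ring.
Qed.

(** Jensen's inequality: the value at radius [r] is the Poisson average of the boundary values, and
    a variance is nonnegative. Folding the circle onto [[0, pi]] produces the symmetrized
    integrand. *)
Lemma pow_sum_poisson N K (r th : R) : (N <= K)%N -> 0 <= r < 1 ->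
  2 * pi * B (pow_sum N K r th) (pow_sum N K r th) <=
  IP (fun t => poisson r t * (circ N K (th + t) + circ N K (th - t))).
Proof.
move=> NK r01; set y := pow_sum N K r th.
pose b n := B (cis (- (n%:R * th)) *: v n) y.
have [cf _] := circ_int NK.
have By : B y y = \sum_(N <= n < K) r ^+ n * b n.
  by rewrite {1}/y /pow_sum form_suml; apply: eq_bigr => n _; rewrite BZl.
have [ch Ih] := sum_IP_poisson N K b r01.
set h := (fun t => _) in ch Ih.
set g := (X in _ <= IP X).
have cp := continuous_poisson r01.
have cg : continuous g.
  apply: continuous_funM => //; apply: continuous_funD => t.
    apply: (@continuous_comp _ _ _ (fun t => th + t) (circ N K)); last exact: cf.
    by apply: cvgD; [exact: cvg_cst|exact: cvg_id].
  apply: (@continuous_comp _ _ _ (fun t => th - t) (circ N K)); last exact: cf.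
  by apply: cvgB => //; exact: cvg_cst.
(* Average [B (pow_sum 1 (th + t) - y) (pow_sum 1 (th + t) - y) >= 0], and the same at
   [th - t], against the Poisson kernel. *)
have E0 : 0 <= IP (fun t => (g t + (- 4) * h t) + (2 * B y y) * poisson r t).
  apply: Rintegral_ge0 => t _; rewrite /g /h.
  have -> : forall a s w z : R, w * a + -4 * (w * s) + z * w = w * (a - 4 * s + z).
    by move=> *; ring.
  apply: mulr_ge0; first exact: poisson_ge0.
  have -> : circ N K (th + t) + circ N K (th - t) -
     4 * (\sum_(N <= n < K) cos (n%:R * t) * b n) + 2 * B y y =
     B (pow_sum N K 1 (th + t) - y) (pow_sum N K 1 (th + t) - y) +
     B (pow_sum N K 1 (th - t) - y) (pow_sum N K 1 (th - t) - y).
    rewrite !form_sqrB -/(circ _ _ _).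
    have -> : 4 * (\sum_(N <= n < K) cos (n%:R * t) * b n) =
       2 * B (pow_sum N K 1 (th + t) + pow_sum N K 1 (th - t)) y.
      rewrite pow_sum1DB form_suml !mulr_sumr; apply: eq_bigr => n _.
      by rewrite BZl /b; ring.
    rewrite BDl /circ; ring.
  by rewrite addr_ge0.
have cE1 : continuous (fun t => g t + -4 * h t) by apply: continuous_funD => //; exact: continuous_funZ.
have E2 : IP (fun t => poisson r t) = pi.
  have := @IP_poisson_cos R r 0 r01; rewrite expr0 mulr1; apply: etrans.
  by apply: eq_Rintegral => t _; rewrite mul0r cos0 mulr1.
move: E0; rewrite RintegralDc //; last exact: continuous_funZ.
rewrite RintegralDc //; last exact: continuous_funZ.
rewrite (RintegralZc 0 pi (-4) ch) (RintegralZc 0 pi (2 * B y y) cp). rewrite Ih E2 -By; lra.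
Qed.

(** [A] is the set where the Hardy-Littlewood maximal function of the restricted [circ N K] exceeds
    [c]; it does not depend on [r]. The constant 12 is the weak-type constant 3 times the 4 of
    [circ_int]. *)
Lemma maximal_pow_sum N K (c : R) : (N <= K)%N -> 0 < c ->
  exists A, [/\ measurable A,
   (mu A <= (12 * pi / c * \sum_(N <= n < K) B (v n) (v n))%:E)%E &
   forall th r : R, -1 <= th <= 1 -> 0 <= r < 1 -> ~ A th ->
     B (pow_sum N K r th) (pow_sum N K r th) <= c].
Proof.
move=> NK c0; have pi0 := pi_gt0 R.
have [cf If] := circ_int NK.
set f := circ N K in cf If.
have f0 t : 0 <= f t by exact: Bge0.
pose D : set R := `[- (2 * pi), 2 * pi]%classic.
have mD : measurable D by exact: measurable_itv.
have intf : mu.-integrable D (EFin \o f) by exact: continuous_integrable_cc.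
have locf : locally_integrable setT (f \_ D) by exact: integrable_locally.
exists [set x | (c%:E < HL_maximal (f \_ D) x)%E]; split.
- rewrite -[X in measurable X]setTI; apply: emeasurable_fun_o_infty => //.
  exact: measurable_HL_maximal.
- apply: le_trans (maximal_inequality locf c0) _.
  have -> : (\int[mu]_(y in setT) `|((f \_ D) y)%:E| = (I4 f)%:E)%E.
    rewrite /Rintegral fineK; last exact: integrable_fin_num.
    rewrite [RHS]integral_mkcond; apply: eq_integral => y _.
    rewrite restrict_EFin /=; congr (_%:E).
    by rewrite patchE; case: ifP => _; rewrite ?normr0 // ger0_norm.
  by rewrite -EFinM lee_fin If le_eqVlt; apply/orP; left; apply/eqP; field; rewrite gt_eqF.
move=> th r thb r01 /= /negP; rewrite -leNgt => HLc.
suff h : forall s : R, 0 < s <= pi -> \int[mu]_(t in `[th - s, th + s]) f t <= 2 * s * c.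
  have h1 := pow_sum_poisson th NK r01.
  have h2 := IP_poisson_le cf r01 h.
  have h3 := le_trans h1 h2.
  have : 2 * pi * B (pow_sum N K r th) (pow_sum N K r th) <= 2 * pi * c by lra.
  by rewrite ler_pM2l // mulr_gt0.
move=> s /andP[s0 sp]; have p2 := pi_ge2 R.
have ballE : ball th s = `]th - s, th + s[%classic by exact: ball_itv.
have sub : ball th s `<=` D.
  by rewrite ballE /D => x /=; rewrite !in_itv /=; lra.
have : (iavg (f \_ D) (ball th s) <= c%:E)%E.
  apply: le_trans HLc; apply: ereal_sup_ubound; exists s => //=.
  by rewrite in_itv /= s0.
rewrite iavg_restrict //; last exact: measurable_ball.
rewrite setIidr // lebesgue_measure_ball ?(ltW s0) //.
have -> : (\int[mu]_(y in ball th s) `|(f y)%:E| = (\int[mu]_(t in `[(th - s)%R, (th + s)%R]) f t)%:E)%E.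
  rewrite /Rintegral fineK; last first.
    by apply: integrable_fin_num => //; exact: continuous_integrable_cc.
  rewrite ballE [RHS]integral_itv_bndoo.
    by apply: eq_integral => y _ /=; rewrite ger0_norm.
  have mf : measurable_fun setT f by exact: continuous_measurable_fun.
  by apply/measurable_EFinP; exact: measurable_funTS.
rewrite inver mulrn_eq0 /= gt_eqF // -EFinM lee_fin.
by rewrite ler_pdivrMl ?mulrn_wgt0 // -[s *+ 2]mulr_natl.
Qed.

Definition snorm u := Num.sqrt (B u u).

Lemma snorm_ge0 u : 0 <= snorm u. Proof. exact: sqrtr_ge0. Qed.

Lemma snorm_sqr u : snorm u ^+ 2 = B u u. Proof. exact: (sqr_sqrtr (Bge0 u)). Qed.

Lemma form_CS u w : B u w <= snorm u * snorm w.
Proof.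
have h a b : 0 <= a ^+ 2 * B u u - 2 * (a * b) * B u w + b ^+ 2 * B w w.
  have := Bge0 (a%:C *: u - b%:C *: w).
  rewrite (form_sqrB) !BZl !(sformZr).
  by congr (0 <= _); ring.
have p0 := snorm_ge0 u; have q0 := snorm_ge0 w.
have := Bge0 u; have := Bge0 w; rewrite -!snorm_sqr.
set p := snorm u in p0 *; set q := snorm w in q0 * => _ _.
have h2 a b : 2 * (a * b) * B u w <= a ^+ 2 * p ^+ 2 + b ^+ 2 * q ^+ 2.
  by have := h a b; rewrite -!snorm_sqr -/p -/q; lra.
(* Null vectors are treated apart because [B] may be degenerate: if [B u w] were positive, a scalar
   making the left side of [h2] equal to [q ^+ 2 + 1] would contradict [h2]. *)
have [p00|pn0] := eqVneq p 0.
  rewrite p00 mul0r leNgt; apply/negP => Bp.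
  have := h2 ((q ^+ 2 + 1) / (2 * B u w)) 1.
  have -> : 2 * ((q ^+ 2 + 1) / (2 * B u w) * 1) * B u w = q ^+ 2 + 1.
    by field; rewrite gt_eqF.
  by rewrite p00 expr0n mulr0 expr1n; lra.
have [q00|qn0] := eqVneq q 0.
  rewrite q00 mulr0 leNgt; apply/negP => Bp.
  have := h2 1 ((p ^+ 2 + 1) / (2 * B u w)).
  have -> : 2 * (1 * ((p ^+ 2 + 1) / (2 * B u w))) * B u w = p ^+ 2 + 1.
    by field; rewrite gt_eqF.
  by rewrite q00 expr0n mulr0 expr1n; lra.
have pq : 0 < p * q by rewrite mulr_gt0 // lt_def ?pn0 ?qn0.
have pq2 : 0 < 2 * (p * q) by rewrite mulr_gt0.
rewrite -(ler_pM2l pq2).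
have := h2 q p; congr (_ <= _); ring.
Qed.

Lemma snormD u w : snorm (u + w) <= snorm u + snorm w.
Proof.
rewrite -(@ler_pXn2r _ 2) ?nnegrE ?addr_ge0 ?snorm_ge0 //.
rewrite snorm_sqr (form_sqrD) -!snorm_sqr.
have := form_CS u w; nra.
Qed.

Lemma snormN u : snorm (- u) = snorm u.
Proof. by rewrite /snorm (sformNl) (sformNr) opprK. Qed.

Lemma snorm_dist u w : `|snorm u - snorm w| <= snorm (u - w).
Proof.
rewrite ler_norml; have h1 := snormD (u - w) w; have h2 := snormD (w - u) u.
rewrite !subrK in h1 h2; rewrite -opprB snormN in h2; lra.
Qed.

Lemma snormZ (a : R) u : snorm (a%:C *: u) = `|a| * snorm u.
Proof.
by rewrite /snorm BZl (sformZr) mulrA -expr2 sqrtrM ?sqr_ge0 // sqrtr_sqr.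
Qed.

Lemma snorm_cis t u : snorm (cis t *: u) = snorm u.
Proof. by rewrite /snorm Bcis. Qed.

Lemma snorm_sum (I : Type) (s : seq I) (F : I -> V) :
  snorm (\sum_(i <- s) F i) <= \sum_(i <- s) snorm (F i).
Proof.
elim/big_rec2: _ => [|i x y _ h]; first by rewrite /snorm (sform0l) sqrtr0.
by rewrite (le_trans (snormD _ _)) // lerD2l.
Qed.

Lemma snorm_pow_sum_cvg N th :
  snorm (pow_sum 0 N r th) @[r --> (1:R)^'-] --> snorm (pow_sum 0 N 1 th).
Proof.
apply/cvgrPdist_le => e e0.
have c : \sum_(0 <= n < N) `|1 - r ^+ n| * snorm (v n) @[r --> (1:R)^'-] --> (0 : R).
  rewrite [X in _ --> X](_ : 0 = \sum_(0 <= n < N) (0 : R)); last by rewrite big1.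
  apply: cvg_big => [|n _]; first exact: add_continuous.
  rewrite -(mul0r (snorm (v n))); apply: cvgM; last exact: cvg_cst.
  rewrite [X in _ --> X](_ : 0 = `|1 - (1 : R) ^+ n|); last by rewrite expr1n subrr normr0.
  apply: cvg_norm; apply: cvgB; first exact: cvg_cst.
  by apply: cvg_at_left_filter; exact: exprn_continuous.
move/cvgrPdist_le : c => /(_ _ e0); apply: filterS => r.
rewrite sub0r normrN ger0_norm; last by apply: sumr_ge0 => n _; rewrite mulr_ge0 ?snorm_ge0.
apply: le_trans; apply: le_trans (snorm_dist _ _) _.
rewrite /pow_sum -sumrB.
apply: le_trans (snorm_sum _ _) _; rewrite le_eqVlt; apply/orP; left; apply/eqP.
by apply: eq_bigr => n _; rewrite -scalerBl -rmorphB snormZ snorm_cis expr1n.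
Qed.

(** The sum of the series is given as [phi], with convergence in the seminorm for each [r < 1],
    since [V] is not assumed complete. *)
Variables (C : R) (phi : R -> R -> V).
Hypothesis vC : forall K, \sum_(0 <= n < K) B (v n) (v n) <= C.
Hypothesis phi_cvg : forall r th, 0 <= r < 1 ->
  snorm (phi r th - pow_sum 0 K r th) @[K --> \oo] --> 0.

Lemma tail_small (e : R) : 0 < e ->
  exists N, forall K, (N <= K)%N -> \sum_(N <= n < K) B (v n) (v n) <= e.
Proof.
move=> e0; pose S K := \sum_(0 <= n < K) B (v n) (v n).
have ndS : nondecreasing_seq S.
  by apply/nondecreasing_seqP => n; rewrite /S big_nat_recr //= lerDl.
have cS : cvgn S.
  by apply: nondecreasing_is_cvgn => //; exists C => _ [n _ <-]; exact: vC.
have Sle K : S K <= limn S by exact: nondecreasing_cvgn_le.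
have /cvgrPdist_le /(_ _ e0) [N _ NS] := cS.
exists N => K NK.
have E : S K = S N + \sum_(N <= n < K) B (v n) (v n).
  by rewrite /S (@big_cat_nat _ _ _ N).
have := NS N (leqnn N); have := Sle K; rewrite E.
by rewrite ler_norml => h /andP[_ h2]; lra.
Qed.

Lemma pow_sum_split N K r th : (N <= K)%N ->
  pow_sum 0 K r th = pow_sum 0 N r th + pow_sum N K r th.
Proof. by move=> NK; rewrite /pow_sum (@big_cat_nat _ _ _ N). Qed.

(** The point is uniformity in [r]. Cutting the series at [N] makes the coefficient tail so small
    that every block [pow_sum N (N + i)] is bounded by [c] off a set of small measure, uniformly in
    [i]; letting [i] grow bounds the whole tail. *)
Lemma tail_negligible (c : R) : 0 < c ->
  exists Z, mu.-negligible Z /\ forall th, -1 <= th <= 1 -> ~ Z th ->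
    exists N, forall r, 0 <= r < 1 -> snorm (phi r th - pow_sum 0 N r th) <= c.
Proof.
move=> c0; have pi0 := pi_gt0 R.
have step (e : R) : 0 < e -> exists Z, [/\ measurable Z, (mu Z <= e%:E)%E &
   forall th, -1 <= th <= 1 -> ~ Z th ->
    exists N, forall r, 0 <= r < 1 -> snorm (phi r th - pow_sum 0 N r th) <= c].
  move=> e0; pose c2 := c ^+ 2; have c20 : 0 < c2 by rewrite exprn_gt0.
  (* A coefficient tail of [e] divided by this factor turns the bound of [maximal_pow_sum] into
     [e]. *)
  have k0 : 0 < 12 * pi / c2 by rewrite divr_gt0 // mulr_gt0.
  have [N NS] := tail_small (divr_gt0 e0 k0).
  have A_ i := cid (maximal_pow_sum (leq_addr i N) c20).
  pose A i := sval (A_ i).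
  have [||mZ Zm] := @measure_liminf_le R A e%:E.
  - by move=> i; rewrite /A; case: (svalP (A_ i)).
  - move=> i; rewrite /A; case: (svalP (A_ i)) => _ h _; apply: le_trans h _.
    by rewrite lee_fin -ler_pdivlMl // mulrC; apply: NS; exact: leq_addr.
  eexists; split; [exact: mZ|exact: Zm|].
  move=> th thb nZ; exists N => r r01.
  (* Good blocks occur for arbitrarily large [i], which is all that the limit in [phi_cvg]
     requires. *)
  have inf j : exists2 i, (j <= i)%N & ~ A i th.
    apply: contrapT => h; apply: nZ; exists j => // i /= ji.
    by apply: contrapT => nA; apply: h; exists i.
  apply/ler_addgt0Pr => d d0.
  have /cvgrPdist_le /(_ _ d0) [j _ jd] := phi_cvg th r01.
  have [i ji nA] := inf j.
  have := jd (N + i)%N; rewrite sub0r normrN ger0_norm ?snorm_ge0 // => /(_ _) h1.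
  have {}h1 := h1 (leq_trans ji (leq_addl _ _)).
  have -> : phi r th - pow_sum 0 N r th =
     (pow_sum N (N + i) r th) + (phi r th - pow_sum 0 (N + i) r th).
    have E (a b x : V) : a - b = x + (a - (b + x)).
      by rewrite opprD !addrA (addrC x) (addrAC a) addrK.
    by rewrite (pow_sum_split _ _ (leq_addr i N)) -E.
  apply: le_trans (snormD _ _) _; apply: lerD => //.
  rewrite -(@ler_pXn2r _ 2) ?nnegrE ?snorm_ge0 ?(ltW c0) // snorm_sqr //.
  by move: nA; rewrite /A; case: (svalP (A_ i)) => _ _ h nA; exact: h.
have Z_ j := cid (step j.+1%:R^-1 (ltac:(by rewrite invr_gt0))).
pose Z j := sval (Z_ j).
have mZ j : measurable (Z j) by rewrite /Z; case: (svalP (Z_ j)).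
have Zm j : (mu (Z j) <= (j.+1%:R^-1)%:E)%E by rewrite /Z; case: (svalP (Z_ j)).
have mI : measurable (\bigcap_j Z j) by exact: bigcapT_measurable.
exists (\bigcap_j Z j); split.
  exists (\bigcap_j Z j); split => //.
  apply/eqP; rewrite eq_le measure_ge0 andbT; apply/lee_addgt0Pr => e e0.
  rewrite add0e; have [j je] := ltr_add_invr e0; rewrite add0r in je.
  apply: (@le_trans _ _ (mu (Z j))).
    apply: le_measure; [by rewrite inE; exact: mI|by rewrite inE; exact: mZ|].
    by move=> x; apply.
  by apply: le_trans (Zm j) _; rewrite lee_fin ltW.
move=> th thb /existsNP [j /not_implyP [_ nZ]].
by move: nZ; rewrite /Z; case: (svalP (Z_ j)) => _ _ h nZ; exact: h.
Qed.

(** Off countably many null sets, [phi] is approximated uniformly in [r] by polynomials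
    [pow_sum 0 N], whose seminorms converge as [r] tends to 1. Uniform approximation transfers the
    Cauchy property. *)
Theorem fatou_hardy : mu.-negligible
  [set th : R | -1 <= th <= 1 /\ ~ left_cauchy (fun r => B (phi r th) (phi r th))].
Proof.
have Z_ k := cid (tail_negligible (ltac:(by rewrite invr_gt0) : 0 < k.+1%:R^-1 :> R)).
pose Z k := sval (Z_ k).
apply: (@negligibleS _ _ _ mu (\bigcup_k Z k)); last first.
  by apply: negligible_bigcup => k; rewrite /Z; case: (svalP (Z_ k)).
move=> th /= [thb]; apply: contra_notP => nZ.
have NZ k : exists N, forall r, 0 <= r < 1 ->
    snorm (phi r th - pow_sum 0 N r th) <= k.+1%:R^-1.
  have nZk : ~ Z k th by move=> h; apply: nZ; exists k.
  by move: nZk; rewrite /Z; case: (svalP (Z_ k)) => _ h nZk; exact: h.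
apply/left_cauchyP.
have -> : (fun r => B (phi r th) (phi r th)) = fun r => snorm (phi r th) * snorm (phi r th).
  by apply/funext => r; rewrite -expr2 snorm_sqr.
suff c : cvg (snorm (phi r th) @[r --> (1 : R)^'-]) by exact: is_cvgM.
apply/left_cauchyP => k.
(* The tolerance is split as a quarter for each of the two approximations and a half for the
   polynomial. *)
have [N hN] := NZ (4 * k.+1)%N.
have /left_cauchyP /(_ (2 * k.+1)%N) [m hm] : cvg (snorm (pow_sum 0 N r th) @[r --> (1 : R)^'-]).
  by apply/cvg_ex; eexists; exact: snorm_pow_sum_cvg.
exists m => r s rb sb.
have m1 : m.+1%:R^-1 <= 1 :> R by rewrite invf_le1 // ler1n.
have h t : 1 - m.+1%:R^-1 < t < 1 ->
    `|snorm (phi t th) - snorm (pow_sum 0 N t th)| <= (4 * k.+1)%N.+1%:R^-1.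
  move=> tb; apply: le_trans (snorm_dist _ _) _; apply: hN.
  by move: (m.+1%:R^-1) m1 tb => q q1 tb; lra.
have hr := h r rb; have hs := h s sb; have := hm r s rb sb.
move: hr hs; rewrite !ler_norml.
have e4 : (4 * k.+1)%N.+1%:R^-1 <= k.+1%:R^-1 / 4 :> R.
  by rewrite -invfM lef_pV2 ?posrE // ?mulr_gt0 // -natrM ler_nat mulnC.
have e2 : (2 * k.+1)%N.+1%:R^-1 <= k.+1%:R^-1 / 2 :> R.
  by rewrite -invfM lef_pV2 ?posrE // ?mulr_gt0 // -natrM ler_nat mulnC.
move: (k.+1%:R^-1) ((4 * k.+1)%N.+1%:R^-1) ((2 * k.+1)%N.+1%:R^-1) e4 e2 => x y z; lra.
Qed.

End fatou.

(** * Null sets and rotations *)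

Section null_preserving.
Context {R : realType}.

(** Preservation of null sets is enough for statements that hold almost everywhere, and it passes
    through shears and scalings without Jacobians. *)
Definition null_preserving d (T : measurableType d) (m : set T -> \bar R) (f : T -> T) :=
  measurable_fun setT f /\
  forall A, measurable A -> m A = 0%E -> m (f @^-1` A) = 0%E.

Lemma null_preserving_comp d (T : measurableType d) (m : set T -> \bar R) (f g : T -> T) :
  null_preserving m f -> null_preserving m g -> null_preserving m (g \o f).
Proof.
move=> [mf nf] [mg ng]; split; first exact: measurableT_comp.
move=> A mA A0; rewrite comp_preimage; apply: nf; last exact: ng.
by rewrite -[X in measurable X]setTI; exact: mg.
Qed.

Lemma null_preserving_id d (T : measurableType d) (m : set T -> \bar R) :
  null_preserving m id.
Proof. by split. Qed.

Section product.
Context d1 d2 (T1 : measurableType d1) (T2 : measurableType d2).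
Variables (m1 : {sigma_finite_measure set T1 -> \bar R}).
Variables (m2 : {sigma_finite_measure set T2 -> \bar R}).

Lemma prod_nullP (A : set (T1 * T2)) : measurable A ->
  (m1 \x m2)%E A = 0%E <-> {ae m1, forall x, m2 (xsection A x) = 0%E}.
Proof.
move=> mA; have mf := measurable_fun_xsection m2 mA.
have -> : (m1 \x m2)%E A = (\int[m1]_x `|(m2 \o xsection A) x|)%E.
  by rewrite /product_measure1; apply: eq_integral => x _; rewrite gee0_abs.
rewrite (ae_eq_integral_abs m1 measurableT mf).
by split; apply: filterS => x /=; [exact|move=> h _].
Qed.

Lemma prod_null2P (A : set (T1 * T2)) : measurable A ->
  (m1 \x m2)%E A = 0%E <-> {ae m2, forall y, m1 (ysection A y) = 0%E}.
Proof.
move=> mA; have mf := measurable_fun_ysection m1 mA.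
have -> : (m1 \x m2)%E A = (\int[m2]_x `|(m1 \o ysection A) x|)%E.
  (* The two iterated integrals define the same measure, by uniqueness on rectangles. *)
  transitivity ((m1 \x^ m2)%E A).
    by apply: product_measure_unique => // B C mB mC /=; rewrite product_measure2E.
  by rewrite /product_measure2; apply: eq_integral => x _; rewrite gee0_abs.
rewrite (ae_eq_integral_abs m2 measurableT mf).
by split; apply: filterS => x /=; [exact|move=> h _].
Qed.

Lemma null_preserving_ae d (T : measurableType d) (m : {measure set T -> \bar R}) f (P : T -> Prop) :
  null_preserving m f -> {ae m, forall x, P x} -> {ae m, forall x, P (f x)}.
Proof.
move=> [mf nf] [N [mN N0 PN]]; exists (f @^-1` N); split.
- by rewrite -[X in measurable X]setTI; exact: mf.
- exact: nf.
- by move=> x /= nP; exact: PN.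
Qed.

(** For a triangular map, the section at [x] of the preimage of [A] is the preimage under [psi x] of
    the section of [A] at [phi x]. *)
Lemma null_preserving_prod (phi : T1 -> T1) (psi : T1 -> T2 -> T2) :
  measurable_fun setT (fun x : T1 * T2 => (phi x.1, psi x.1 x.2)) ->
  null_preserving m1 phi -> (forall x, null_preserving m2 (psi x)) ->
  null_preserving (m1 \x m2)%E (fun x : T1 * T2 => (phi x.1, psi x.1 x.2)).
Proof.
move=> mf nphi npsi; split => // A mA /(prod_nullP mA) A0.
apply/prod_nullP.
  by rewrite -[X in measurable X]setTI; exact: mf.
apply: filterS (null_preserving_ae nphi A0) => x h.
rewrite (_ : xsection _ x = psi x @^-1` xsection A (phi x)).
  by have [_] := npsi x; apply => //; exact: measurable_xsection.
by apply/seteqP; split => y; rewrite /xsection /= !inE.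
Qed.

Lemma null_preserving_prod2 (psi : T2 -> T1 -> T1) :
  measurable_fun setT (fun x : T1 * T2 => (psi x.2 x.1, x.2)) ->
  (forall x, null_preserving m1 (psi x)) ->
  null_preserving (m1 \x m2)%E (fun x : T1 * T2 => (psi x.2 x.1, x.2)).
Proof.
move=> mf npsi; split => // A mA /(prod_null2P mA) A0.
apply/prod_null2P.
  by rewrite -[X in measurable X]setTI; exact: mf.
apply: filterS A0 => y h.
rewrite (_ : ysection _ y = psi y @^-1` ysection A y).
  by have [_] := npsi y; apply => //; exact: measurable_ysection.
by apply/seteqP; split => x; rewrite /ysection /= !inE.
Qed.

End product.

Lemma measurable_affine (a b : R) :
  measurable_fun setT (fun x : measurableTypeR R => a * x + b : measurableTypeR R).
Proof. by apply: measurable_funD => //; exact: measurable_funM. Qed.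

(** [a] times the image of Lebesgue measure agrees with it on half-open intervals, hence everywhere
    by uniqueness. *)
Lemma null_preserving_affine (a b : R) : 0 < a ->
  null_preserving (@lebesgue_measure R) (fun x => a * x + b).
Proof.
move=> a0; split; first exact: measurable_affine.
move=> A mA A0.
pose m := mscale (NngNum (ltW a0))
  (measure_function_pushforward__canonical__measure_function_Measure
     (@lebesgue_measure R) (measurable_affine a b)).
have := @lebesgue_measure_unique R m _ A mA.
rewrite A0 => /(_ _)/esym/eqP; rewrite /m /mscale /= mule_eq0 => h.
have /h /orP[|/eqP //] : forall X, ocitv X -> lebesgue_measure X = m X.
  move=> _ [[l u]] _ <-; rewrite /m /mscale /= /pushforward.
  rewrite (_ : _ @^-1` _ = `](l - b) / a, (u - b) / a]%classic); last first.
    apply/seteqP; split => x /=; rewrite !in_itv /= ltr_pdivrMr // ler_pdivlMr //;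
      rewrite ltrBlDr lerBrDr (mulrC x); exact.
  rewrite !lebesgue_measure_itv /= !lte_fin ltr_pM2r ?invr_gt0 // ltrD2r.
  case: ifP => _; rewrite -?EFinB -?EFinM; congr EFin; last by rewrite mulr0.
  by field; rewrite gt_eqF.
by move=> /eqP [] /= /eqP; rewrite gt_eqF.
Qed.

End null_preserving.

(** * Rotations of C^d and slicing by circles *)

Section rotation.
Context {R : realType}.
Local Notation plane := (measurableTypeR R * measurableTypeR R)%type.

Definition prot (c s : R) (p : plane) : plane :=
  (c * p.1 - s * p.2, s * p.1 + c * p.2).

Lemma measurable_lin (a b : R) :
  measurable_fun setT (fun p : plane => a * p.1 + b * p.2 : measurableTypeR R).
Proof. by apply: measurable_funD; apply: measurable_funM. Qed.

Lemma measurable_prot c s : measurable_fun setT (prot c s).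
Proof.
apply: measurable_fun_pair; last exact: measurable_lin.
under eq_fun do rewrite -mulNr; exact: measurable_lin.
Qed.

(* A rotation is a product of two shears. *)
Lemma null_preserving_prot c s : 0 < c -> c ^+ 2 + s ^+ 2 = 1 ->
  null_preserving (@lebesgue_plane R) (prot c s).
Proof.
move=> c0 cs.
pose f1 (p : plane) : plane := (c * p.1 + - s * p.2, p.2).
pose f2 (p : plane) : plane := (p.1, c^-1 * p.2 + s / c * p.1).
have -> : prot c s = f2 \o f1.
  apply/funext => -[x y]; rewrite /prot /f2 /f1 /=; congr pair; first by ring.
  have -> : s * x + c * y = s * x + (c * c) * y / c by field; rewrite gt_eqF.
  have -> : c * c = 1 - s ^+ 2 by rewrite -cs expr2; ring.
  by field; rewrite gt_eqF.
apply: null_preserving_comp.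
  apply: (@null_preserving_prod2 R _ _ (measurableTypeR R) (measurableTypeR R)
    (@lebesgue_measure R) (@lebesgue_measure R) (fun y x => c * x + - s * y)).
    by apply: measurable_fun_pair => //; exact: measurable_lin.
  by move=> y; exact: null_preserving_affine.
apply: (@null_preserving_prod R _ _ (measurableTypeR R) (measurableTypeR R)
  (@lebesgue_measure R) (@lebesgue_measure R) id (fun x y => c^-1 * y + s / c * x)).
- apply: measurable_fun_pair => //.
  under eq_fun do rewrite addrC; exact: measurable_lin.
- exact: null_preserving_id.
- by move=> x; apply: null_preserving_affine; rewrite invr_gt0.
Qed.

Definition zrot d (c s : R) (z : Cn R d) : Cn R d :=
  [tuple prot c s (tnth z k) | k < d].

Lemma measurable_zrot d c s : measurable_fun setT (@zrot d c s).
Proof.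
apply/measurable_fun_tnthP => k.
rewrite (_ : _ \o _ = fun z => prot c s (tnth z k)); last first.
  by apply/funext => z /=; rewrite tnth_mktuple.
by apply: measurableT_comp; [exact: measurable_prot|exact: measurable_tnth].
Qed.

Lemma null_preserving_zrot d c s : 0 < c -> c ^+ 2 + s ^+ 2 = 1 ->
  null_preserving (volume R d) (@zrot d c s).
Proof.
move=> c0 cs; elim: d => [|d IH].
  have -> : @zrot 0 c s = id by apply/funext => z; rewrite (tuple0 z) (tuple0 (zrot _ _ _)).
  exact: null_preserving_id.
split; first exact: measurable_zrot.
move=> A mA; rewrite /volume /= /power_step /pushforward => A0.
have := @null_preserving_prod _ _ _ _ _ _ _ (prot c s) (fun=> @zrot d c s) _
  (null_preserving_prot c0 cs) (fun=> IH).
case.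
  apply: measurable_fun_pair.
    by apply: measurableT_comp => //; exact: measurable_prot.
  by apply: measurableT_comp => //; exact: measurable_zrot.
move=> mf /(_ (@tcons _ _ d @^-1` A)) h.
rewrite (_ : _ @^-1` _ = (fun x : plane * Cn R d => (prot c s x.1, zrot c s x.2)) @^-1`
    (@tcons _ _ d @^-1` A)).
  by apply: h => //; rewrite -[X in measurable X]setTI; exact: measurable_tcons.
apply/seteqP; split => -[x t] /=.
all: suff -> : zrot c s (tcons (x, t)) = tcons (prot c s x, zrot c s t) by [].
all: apply/eq_from_tnth => k; rewrite tnth_mktuple.
all: case: (unliftP ord0 k) => [j ->|->]; rewrite ?tnth_tconsS ?tnth_tcons0 //=.
all: by rewrite tnth_mktuple.
Qed.

Lemma zrotK d c s (z : Cn R d) : c ^+ 2 + s ^+ 2 = 1 -> zrot c s (zrot c (- s) z) = z.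
Proof.
move=> cs; apply/eq_from_tnth => k; rewrite !tnth_mktuple /prot /=.
case: (tnth z k) => x y /=; congr pair.
  by rewrite -[RHS]mul1r -cs; ring.
by rewrite -[RHS]mul1r -cs; ring.
Qed.

Lemma measurable_zrot_pair d :
  measurable_fun setT (fun x : measurableTypeR R * Cn R d => zrot (cos x.1) (sin x.1) x.2).
Proof.
apply/measurable_fun_tnthP => k.
rewrite (_ : _ \o _ = fun x : measurableTypeR R * Cn R d =>
  prot (cos x.1) (sin x.1) (tnth x.2 k)); last first.
  by apply/funext => z /=; rewrite tnth_mktuple.
have mc : measurable_fun setT (fun x : measurableTypeR R * Cn R d => cos x.1 : measurableTypeR R).
  by apply: (measurableT_comp (f := cos)) => //; apply: continuous_measurable_fun; exact: continuous_cos.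
have ms : measurable_fun setT (fun x : measurableTypeR R * Cn R d => sin x.1 : measurableTypeR R).
  by apply: (measurableT_comp (f := sin)) => //; apply: continuous_measurable_fun; exact: continuous_sin.
have mk : measurable_fun setT (fun x : measurableTypeR R * Cn R d => tnth x.2 k).
  by apply: (measurableT_comp (f := fun z : Cn R d => tnth z k)) => //; exact: measurable_tnth.
have mk1 := measurableT_comp (measurable_fst) mk.
have mk2 := measurableT_comp (measurable_snd) mk.
apply: measurable_fun_pair; first by apply: measurable_funB; exact: measurable_funM.
by apply: measurable_funD; exact: measurable_funM.
Qed.

(** Fubini is applied twice to the pairs of an angle and a point whose rotation lies in [E]: null
    slices in the angle give a null set [Q], so some angle has a null slice in C^d, and rotating
    that slice back gives [E]. *)
Lemma volume_slice0 d (E : set (Cn R d)) : measurable E ->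
  (forall z, (@lebesgue_measure R).-negligible
     [set th : R | -1 <= th <= 1 /\ E (zrot (cos th) (sin th) z)]) ->
  volume R d E = 0%E.
Proof.
move=> mE Eslice.
pose rot (x : measurableTypeR R * Cn R d) := zrot (cos x.1) (sin x.1) x.2.
pose I : set (measurableTypeR R) := `]-1, 1[%classic.
have mI : measurable I by exact: measurable_itv.
pose Q := (I `*` setT) `&` (rot @^-1` E).
have mQ : measurable Q.
  apply: measurableI; first exact: measurableX.
  by rewrite -[X in measurable X]setTI; exact: measurable_zrot_pair.
have /(prod_nullP _ _ mQ) [N [mN N0 QN]] : (@lebesgue_measure R \x volume R d)%E Q = 0%E.
  apply/(prod_null2P _ _ mQ); apply: aeW => z.
  apply/negligibleP; first exact: measurable_ysection.
  apply: negligibleS (Eslice z) => th.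
  rewrite /ysection /= inE => -[[/= thI _] Eth]; split => //.
  by move: thI; rewrite /I /= in_itv /= => /andP[/ltW -> /ltW ->].
(* [I] has positive length, so the null set [N] cannot cover it. *)
have [th thI thN] : exists2 th, I th & ~ N th.
  apply: contrapT => h.
  have IN : I `<=` N by move=> t It; apply: contrapT => nN; apply: h; exists t.
  have : (@lebesgue_measure R) I = 0%E by exact: (subset_measure0 mI mN IN N0).
  rewrite /I lebesgue_measure_itv /= lte_fin ifT; last lra.
  by move=> []; lra.
have v0 : volume R d (xsection Q th) = 0%E.
  by apply: contrapT => h; apply: thN; apply: QN.
have thb : -1 < th < 1 by move: thI; rewrite /I /= in_itv.
have c0 : 0 < cos th.
  by apply: cos_gt0_pihalf; have := pihalf_ge1 R; lra.
have [_ nz] := @null_preserving_zrot d (cos th) (- sin th) c0 (etrans (congr1 _ (sqrrN _)) (cos2Dsin2 th)).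
have := nz _ (measurable_xsection th mQ) v0.
rewrite (_ : _ @^-1` _ = E) //; apply/seteqP; split => z; rewrite /xsection /= inE.
  by move=> [_]; rewrite /rot /= zrotK // cos2Dsin2.
by move=> Ez; split => //; rewrite /rot /= zrotK // cos2Dsin2.
Qed.

End rotation.

(** * Hilbert spaces *)

Section hilbert.
Context {R : realType} (H : hilbertType R).
Implicit Types x y z w : H.

Definition rdot x y : R := complex.Re (hdot x y).

Lemma hdotC x y : hdot x y = Num.conj (hdot y x).
Proof. by rewrite (hermC hdot) expr0 mul1r. Qed.

Lemma hdotDl x y z : hdot (x + y) z = hdot x z + hdot y z.
Proof. exact: linearDl. Qed.

Lemma hdotDr x y z : hdot z (x + y) = hdot z x + hdot z y.
Proof. exact: linearDr. Qed.

Lemma hdotZl a x z : hdot (a *: x) z = a * hdot x z.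
Proof. exact: linearZl_LR. Qed.

Lemma hdotZr a x z : hdot z (a *: x) = Num.conj a * hdot z x.
Proof. exact: linearZr_LR. Qed.

Lemma hdotBl x y z : hdot (x - y) z = hdot x z - hdot y z.
Proof. exact: linearBl. Qed.

Lemma hdotBr x y z : hdot z (x - y) = hdot z x - hdot z y.
Proof. exact: linearBr. Qed.

Lemma hdot0l z : hdot 0 z = 0. Proof. exact: linear0l. Qed.

Lemma hdot_suml (I : Type) (s : seq I) (F : I -> H) z :
  hdot (\sum_(i <- s) F i) z = \sum_(i <- s) hdot (F i) z.
Proof. by elim/big_rec2: _ => [|i x y _ <-]; rewrite ?hdot0l ?hdotDl. Qed.

Lemma hdot_sumr (I : Type) (s : seq I) (F : I -> H) z :
  hdot z (\sum_(i <- s) F i) = \sum_(i <- s) hdot z (F i).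
Proof.
by rewrite hdotC hdot_suml rmorph_sum; apply: eq_bigr => i _; rewrite [RHS]hdotC.
Qed.

Lemma ReD (a b : R[i]) : complex.Re (a + b) = complex.Re a + complex.Re b.
Proof. by case: a b => ? ? []. Qed.

Lemma Re_conj (a : R[i]) : complex.Re (Num.conj a) = complex.Re a.
Proof. by case: a. Qed.

Lemma rdotC x y : rdot x y = rdot y x.
Proof. by rewrite /rdot hdotC Re_conj. Qed.

Lemma rdotDl x y z : rdot (x + y) z = rdot x z + rdot y z.
Proof. by rewrite /rdot hdotDl ReD. Qed.

Lemma rdotZl (a : R) x z : rdot (a%:C *: x) z = a * rdot x z.
Proof. by rewrite /rdot hdotZl; case: (hdot x z) => u v /=; rewrite mul0r subr0. Qed.

Lemma hdot_cis t x y : hdot (cis t *: x) (cis t *: y) = hdot x y.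
Proof.
by rewrite hdotZl hdotZr mulrA conj_cis -cisD subrr cis0 mul1r.
Qed.

Lemma rdot_cis t x y : rdot (cis t *: x) (cis t *: y) = rdot x y.
Proof. by rewrite /rdot hdot_cis. Qed.

Lemma rdot_sqr x : (rdot x x)%:C = hdot x x.
Proof.
have : 0 <= hdot x x by rewrite hdotE exprn_ge0.
by rewrite /rdot lecE /= => /andP[/eqP h _]; case: (hdot x x) h => a b /= ->.
Qed.

Lemma rdot_ge0 x : 0 <= rdot x x.
Proof.
have : 0 <= hdot x x by rewrite hdotE exprn_ge0.
by rewrite -rdot_sqr lecR.
Qed.

Local Notation nm := (snorm rdot).

(** The norm of [H] takes values in [R[i]]; [nm] is the same number in [R], where order and limits
    are easier to handle. *)
Lemma normHE x : `|x| = (nm x)%:C.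
Proof.
apply/eqP; rewrite -(@eqrXn2 _ 2) // ?ler0c ?snorm_ge0 //.
by rewrite -hdotE -rmorphXn /= (snorm_sqr rdot_ge0) rdot_sqr.
Qed.

Lemma nm_ge0 x : 0 <= nm x. Proof. exact: snorm_ge0. Qed.

Lemma nm_sqr x : nm x ^+ 2 = rdot x x.
Proof. exact: (snorm_sqr rdot_ge0). Qed.

Lemma nm0 : nm 0 = 0.
Proof. by rewrite /snorm /rdot hdot0l sqrtr0. Qed.

Lemma nm_eq0 x : nm x = 0 -> x = 0.
Proof. by move=> h; apply/eqP; rewrite -normr_eq0 normHE h. Qed.

Lemma nmZ (a : R[i]) x : (nm (a *: x))%:C = `|a| * (nm x)%:C.
Proof. by rewrite -!normHE normrZ. Qed.

Lemma nmD x y : nm (x + y) <= nm x + nm y.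
Proof. exact: (snormD rdotC rdotDl rdotZl rdot_ge0). Qed.

Lemma nmN x : nm (- x) = nm x.
Proof. exact: (snormN rdotC rdotZl). Qed.

Lemma nm_dist x y : `|nm x - nm y| <= nm (x - y).
Proof. exact: (snorm_dist rdotC rdotDl rdotZl rdot_ge0). Qed.

Lemma rdot_CS x y : rdot x y <= nm x * nm y.
Proof. exact: (form_CS rdotC rdotDl rdotZl rdot_ge0). Qed.

Lemma rdotBr x y z : rdot z (x - y) = rdot z x - rdot z y.
Proof. by rewrite /rdot hdotBr; case: (hdot z x) (hdot z y) => ? ? []. Qed.

Lemma rdotBl x y z : rdot (x - y) z = rdot x z - rdot y z.
Proof. by rewrite rdotC rdotBr !(rdotC z). Qed.

Lemma hdot_ext (f g : R[i]) : complex.Re f = complex.Re g ->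
  complex.Re ('i%C * f) = complex.Re ('i%C * g) -> f = g.
Proof.
case: f g => a b [a' b'] /= -> ; rewrite !mul0r !mul1r !sub0r => /oppr_inj -> //.
Qed.

Lemma H_complete (u : nat -> H) :
  (forall e : R, 0 < e -> exists N, forall m n, (N <= m)%N -> (N <= n)%N ->
    nm (u m - u n) <= e) ->
  exists l, nm (u n - l) @[n --> \oo] --> 0.
Proof.
move=> uc.
have : cvg (u n @[n --> \oo]).
  apply/cauchy_cvgP/cauchyP => e e0.
  have [e' e'E] : exists e', e = e'%:C.
    by apply/complex_realP; rewrite realE (ltW e0).
  have e'0 : 0 < e' by rewrite e'E ltcR in e0.
  have [|N hN] := uc (e' / 2); first by rewrite divr_gt0.
  exists (u N); exists N => // n /= Nn.
  rewrite -ball_normE /ball_/= normHE e'E ltcR.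
  by apply: le_lt_trans (hN N n (leqnn _) Nn) _; lra.
move=> /cvg_ex [l /cvgrPdist_le ul]; exists l.
apply/cvgrPdist_le => e e0.
have eC : 0 < e%:C by rewrite ltcR.
have := ul _ eC; apply: filterS => n.
by rewrite normHE lecR sub0r normrN ger0_norm ?nm_ge0 // -nmN opprB.
Qed.

Lemma nm_cvg_rdot (u : nat -> H) l w : nm (u n - l) @[n --> \oo] --> 0 ->
  rdot (u n) w @[n --> \oo] --> rdot l w.
Proof.
move=> /cvgrPdist_le ul; apply/cvgrPdist_le => e e0.
have e0' : 0 < e / (nm w + 1) by rewrite divr_gt0 // ltr_wpDl ?nm_ge0.
have := ul _ e0'; apply: filterS => n.
rewrite sub0r normrN ger0_norm ?nm_ge0 // ler_pdivlMr ?ltr_wpDl ?nm_ge0 // => h.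
have h2 : nm (u n - l) * nm w <= e.
  by apply: le_trans h; rewrite ler_wpM2l ?nm_ge0 // lerDl.
rewrite -rdotBl ler_norml; apply/andP; split.
  rewrite lerNl; apply: le_trans h2; rewrite -opprB rdotC.
  have -> : - rdot w (- (u n - l)) = rdot (u n - l) w.
    by rewrite rdotC /rdot linearNl /=; case: (hdot _ _) => ? ? /=; rewrite opprK.
  exact: rdot_CS.
by apply: le_trans h2; rewrite -nmN opprB; exact: rdot_CS.
Qed.

Lemma nm_cvg_unique (u : nat -> H) l l' : nm (u n - l) @[n --> \oo] --> 0 ->
  nm (u n - l') @[n --> \oo] --> 0 -> l = l'.
Proof.
move=> ul ul'; apply/eqP; rewrite -subr_eq0; apply/eqP/nm_eq0.
have h : nm (u n - l) + nm (u n - l') @[n --> \oo] --> (0 : R).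
  by rewrite [X in _ --> X](_ : 0 = 0 + 0); [exact: cvgD|rewrite addr0].
apply/eqP; rewrite eq_le nm_ge0 andbT.
apply: (cvgr_to_ge h); apply: nearW => n /=.
have -> : l - l' = - (u n - l) + (u n - l') by rewrite opprB addrA subrK.
by apply: le_trans (nmD _ _) _; rewrite nmN.
Qed.

(* The representing vector minimizes [|x|^2 - 2 Re f x]. *)
Lemma riesz (f : H -> R[i]) (C : R) :
  (forall a x y, f (a *: x + y) = a * f x + f y) ->
  (forall x, complex.Re (f x) <= C * nm x) ->
  exists z, forall x, f x = hdot x z.
Proof.
move=> flin fC.
pose F x := complex.Re (f x).
have FD x y : F (x + y) = F x + F y.
  by rewrite /F -(scale1r x) flin mul1r ReD scale1r.
have F0 : F 0 = 0 by apply: (addrI (F 0)); rewrite -FD !addr0.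
have FZ (a : R) x : F (a%:C *: x) = a * F x.
  rewrite /F -(addr0 (_ *: x)) flin ReD -/(F 0) F0 addr0.
  by case: (f x) => u v /=; rewrite mul0r subr0.
pose J x := rdot x x - 2 * F x.
have JD x w (t : R) : J (x + t%:C *: w) = J x + 2 * t * (rdot x w - F w) + t ^+ 2 * rdot w w.
  rewrite /J (form_sqrD rdotC rdotDl) FD FZ rdotZl !(sformZr rdotC rdotZl); ring.
have Jlb x : - C ^+ 2 <= J x.
  rewrite /J -nm_sqr; have fx : F x <= C * nm x by exact: fC.
  have := sqr_ge0 (nm x - C); rewrite sqrrB; lra.
have Jinf : has_inf (range J).
  by split; [exists (J 0); exists 0|exists (- C ^+ 2) => _ [x _ <-]].
pose m := inf (range J).
have mJ x : m <= J x by apply: ge_inf; [case: Jinf|exists x].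
have u_ n : exists x, J x <= m + n.+1%:R^-1.
  have n0 : 0 < n.+1%:R^-1 :> R by rewrite invr_gt0.
  by have [_ [x _ <-] /ltW] := inf_adherent n0 Jinf; exists x.
pose u n := sval (cid (u_ n)).
have uJ n : J (u n) <= m + n.+1%:R^-1 by exact: (svalP (cid (u_ n))).
have par p q : rdot (u p - u q) (u p - u q) <= 2 * (p.+1%:R^-1 + q.+1%:R^-1).
  (* Comparison at the midpoint, as in the parallelogram law, makes the minimizing sequence
     Cauchy. *)
  have h := mJ (u q + (2^-1)%:C *: (u p - u q)).
  rewrite JD in h; have hp := uJ p; have hq := uJ q.
  have Ep : J (u p) = J (u q) + 2 * (rdot (u q) (u p - u q) - F (u p - u q)) + rdot (u p - u q) (u p - u q).
    have := JD (u q) (u p - u q) 1; rewrite scale1r addrC subrK => ->; ring.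
  by move: (p.+1%:R^-1) (q.+1%:R^-1) hp hq => P Q; lra.
have uc (e : R) : 0 < e -> exists N, forall m n, (N <= m)%N -> (N <= n)%N -> nm (u m - u n) <= e.
  move=> e0; have e20 : 0 < e ^+ 2 / 4 by rewrite divr_gt0 // exprn_gt0.
  have [N] := ltr_add_invr e20; rewrite add0r => Ne.
  exists N => p q Np Nq.
  rewrite -(@ler_pXn2r _ 2) ?nnegrE ?nm_ge0 ?(ltW e0) // nm_sqr.
  apply: le_trans (par p q) _.
  have hp : p.+1%:R^-1 <= N.+1%:R^-1 :> R by rewrite lef_pV2 ?posrE // ler_nat.
  have hq : q.+1%:R^-1 <= N.+1%:R^-1 :> R by rewrite lef_pV2 ?posrE // ler_nat.
  by move: (p.+1%:R^-1) (q.+1%:R^-1) (N.+1%:R^-1) hp hq Ne => P Q S; lra.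
have [z uz] := H_complete uc.
have var w t : 0 <= 2 * t * (rdot z w - F w) + t ^+ 2 * rdot w w.
  have c1 : (n.+1%:R^-1 : R) + (2 * t * (rdot (u n) w - F w) + t ^+ 2 * rdot w w) @[n --> \oo]
      --> 0 + (2 * t * (rdot z w - F w) + t ^+ 2 * rdot w w).
    apply: cvgD; first exact: cvg_harmonic.
    apply: cvgD; last exact: cvg_cst.
    apply: cvgM; first exact: cvg_cst.
    by apply: cvgB; [exact: nm_cvg_rdot|exact: cvg_cst].
  rewrite -[X in _ <= X]add0r; apply: (cvgr_to_ge c1); apply: nearW => n.
  have := mJ (u n + t%:C *: w); have := uJ n; rewrite JD.
  by move: (n.+1%:R^-1) => e; lra.
have zF w : F w = rdot w z.
  rewrite (rdotC w); apply/eqP; rewrite eq_sym -subr_eq0; apply/eqP.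
  set D := rdot z w - F w; have hv t := var w t; have w0 := rdot_ge0 w.
  (* A near-optimal [t]; the added 1 keeps the denominator positive when [w = 0]. *)
  have := hv (- D / (rdot w w + 1)).
  have -> : 2 * (- D / (rdot w w + 1)) * (rdot z w - F w) + (- D / (rdot w w + 1)) ^+ 2 * rdot w w =
     - (D ^+ 2 * (rdot w w + 2) / (rdot w w + 1) ^+ 2).
    by rewrite -/D; field; rewrite gt_eqF // ltr_wpDl.
  rewrite oppr_ge0 => h.
  have D2 : D ^+ 2 * (rdot w w + 2) <= 0.
    by move: h; rewrite pmulr_lle0 // invr_gt0 exprn_gt0 // ltr_wpDl.
  have /eqP : D ^+ 2 <= 0 by move: D2; rewrite pmulr_lle0 // ltr_wpDl.
  move=> h3; apply/eqP; rewrite -sqrf_eq0 eq_le sqr_ge0 andbT; exact/eqP.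
exists z => x; apply: hdot_ext; first exact: zF.
have := zF ('i%C *: x); rewrite /F -(addr0 (_ *: x)) flin ReD -/(F 0) F0 !addr0 => ->.
by rewrite /rdot hdotZl.
Qed.

End hilbert.

(** * Adjoints and Neumann series *)

Section adjoint.
Context {R : realType} (H : hilbertType R).
Implicit Types (x y z w : H) (T : H -> H).
Local Notation nm := (snorm (@rdot R H)).

Lemma adjointP T (C : R) : linear T -> (forall x, nm (T x) <= C * nm x) ->
  forall x y, hdot (T x) y = hdot x (adjoint T y).
Proof.
move=> linT TC x y; rewrite /adjoint.
have [z zE] : exists z, forall x, hdot (T x) y = hdot x z.
  apply: (riesz (C := C * nm y)).
    by move=> a u v; rewrite linT hdotDl hdotZl.
  move=> u; apply: le_trans (rdot_CS _ _) _; rewrite mulrAC.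
  by rewrite ler_wpM2r ?nm_ge0.
by have := xgetI (0 : H) (P := [set z | forall x, hdot (T x) y = hdot x z]) zE; apply.
Qed.

Lemma hdot_inj y z : (forall x, hdot x y = hdot x z) -> y = z.
Proof.
move=> h; apply/eqP; rewrite -subr_eq0; apply/eqP/nm_eq0/eqP.
by rewrite -sqrf_eq0 nm_sqr /rdot hdotBr h subrr.
Qed.

Lemma adjoint_linear T (C : R) : linear T -> (forall x, nm (T x) <= C * nm x) ->
  linear (adjoint T).
Proof.
move=> linT TC a x y; apply: hdot_inj => w.
rewrite -(adjointP linT TC) !hdotDr !hdotZr.
by rewrite -!(adjointP linT TC).
Qed.

Lemma adjoint_le T (C : R) : 0 <= C -> linear T -> (forall x, nm (T x) <= C * nm x) ->
  forall x, nm (adjoint T x) <= C * nm x.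
Proof.
move=> C0 linT TC x; set y := adjoint T x.
have [y0|y0] := eqVneq (nm y) 0; first by rewrite y0 mulr_ge0 ?nm_ge0.
have yp : 0 < nm y by rewrite lt_def y0 nm_ge0.
rewrite -(ler_pM2l yp) -expr2 nm_sqr {1 2}/y /rdot -(adjointP linT TC).
apply: le_trans (rdot_CS _ _) _.
by rewrite mulrA ler_wpM2r ?nm_ge0 // mulrC; exact: TC.
Qed.

Lemma linearB_fun T : linear T -> forall x y, T (x - y) = T x - T y.
Proof. by move=> linT x y; rewrite -scaleN1r addrC linT scaleN1r addrC. Qed.

Lemma linearD_fun T : linear T -> forall x y, T (x + y) = T x + T y.
Proof. by move=> linT x y; rewrite -{1}(scale1r x) linT scale1r. Qed.

Lemma linear0_fun T : linear T -> T 0 = 0.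
Proof. by move=> linT; rewrite -{1}(subrr 0) linearB_fun // subrr. Qed.

Lemma linearZ_fun T : linear T -> forall a x, T (a *: x) = a *: T x.
Proof. by move=> linT a x; rewrite -[a *: x]addr0 linT linear0_fun // addr0. Qed.

Lemma linear_sum_fun T : linear T -> forall (I : Type) (s : seq I) (F : I -> H),
  T (\sum_(i <- s) F i) = \sum_(i <- s) T (F i).
Proof.
move=> linT I s F; elim/big_rec2: _ => [|i x y _ <-]; first exact: linear0_fun.
exact: linearD_fun.
Qed.

Lemma iter_le T (q : R) n x : 0 <= q -> (forall x, nm (T x) <= q * nm x) ->
  nm (iter n T x) <= q ^+ n * nm x.
Proof.
move=> q0 Tq; elim: n => [|n IH]; first by rewrite mul1r.
by rewrite iterS exprS -mulrA (le_trans (Tq _)) // ler_wpM2l.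
Qed.

Lemma geo_tail_le (q : R) m n : 0 <= q < 1 ->
  \sum_(m <= k < n) q ^+ k <= q ^+ m / (1 - q).
Proof.
move=> /andP[q0 q1]; have q1' : 0 < 1 - q by rewrite subr_gt0.
rewrite ler_pdivlMr //; case: (leqP m n) => mn; last first.
  by rewrite big_geq ?mul0r ?exprn_ge0 // ltnW.
suff -> : (\sum_(m <= k < n) q ^+ k) * (1 - q) = q ^+ m - q ^+ n.
  by rewrite lerBlDr lerDl exprn_ge0.
rewrite big_distrl /=.
under eq_bigr do rewrite mulrBr mulr1 -exprSr -opprB.
by rewrite sumrN telescope_sumr // opprB.
Qed.

(** The convergence of the partial sums is kept with the solution: it later yields both the power
    series of the resolvent and its measurability. *)
Lemma neumann T (q : R) x : 0 <= q < 1 -> linear T ->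
  (forall x, nm (T x) <= q * nm x) ->
  exists h, h - T h = x /\
    nm (\sum_(0 <= k < n) iter k T x - h) @[n --> \oo] --> 0.
Proof.
move=> q01 linT Tq; have /andP[q0 q1] := q01.
pose u n := \sum_(0 <= k < n) iter k T x.
have q1' : 0 < 1 - q by rewrite subr_gt0.
pose c := nm x / (1 - q).
have c0 : 0 <= c by rewrite divr_ge0 ?nm_ge0 // ltW.
have ule m n : (m <= n)%N -> nm (u n - u m) <= q ^+ m * c.
  move=> mn; rewrite /u (@big_cat_nat _ _ _ m 0 n) //= addrAC subrr add0r.
  apply: le_trans (snorm_sum (@rdotC R H) (@rdotDl R H) (@rdotZl R H) (@rdot_ge0 R H) _ _) _.
  apply: (@le_trans _ _ (\sum_(m <= k < n) q ^+ k * nm x)).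
    by apply: ler_sum => k _; exact: iter_le.
  rewrite -big_distrl /= /c mulrA mulrAC ler_wpM2r ?nm_ge0 //.
  exact: geo_tail_le.
have qc : q ^+ n * c @[n --> \oo] --> 0.
  by rewrite -(mul0r c); apply: cvgM; [apply: cvg_expr; rewrite ger0_norm|exact: cvg_cst].
have [|h uh] := H_complete (u := u).
  move=> e e0; have /cvgrPdist_le /(_ _ e0) [N _ hN] := qc.
  have small k m : (N <= k)%N -> (k <= m)%N -> nm (u m - u k) <= e.
    move=> Nk km; apply: le_trans (ule _ _ km) _.
    by have := hN k Nk; rewrite sub0r normrN ger0_norm // mulr_ge0 // exprn_ge0.
  exists N => m n Nm Nn; case: (leqP n m) => mn; first exact: small.
  by rewrite -nmN opprB small // ltnW.
exists h; split => //.
have uS n : u n.+1 = x + T (u n).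
  by rewrite /u big_nat_recl //= (linear_sum_fun linT).
have uTh : nm (u n.+1 - (x + T h)) @[n --> \oo] --> 0.
  have c1 : q * nm (u n - h) @[n --> \oo] --> 0.
    by rewrite -(mulr0 q); apply: cvgM => //; exact: cvg_cst.
  apply: (squeeze_cvgr _ (cvg_cst (0 : R)) c1); apply: nearW => n; rewrite nm_ge0 /=.
  by rewrite uS opprD addrACA subrr add0r -linearB_fun.
have uh' : nm (u n.+1 - h) @[n --> \oo] --> 0.
  by have := uh; rewrite -(cvg_shiftS (fun n => nm (u n - h))).
by rewrite {1}(nm_cvg_unique uh' uTh) addrK.
Qed.

Lemma neumann_unique T (q : R) h h' : q < 1 -> linear T ->
  (forall x, nm (T x) <= q * nm x) -> h - T h = h' - T h' -> h = h'.
Proof.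
move=> q1 linT Tq hh; apply/eqP; rewrite -subr_eq0; apply/eqP/nm_eq0.
have e : h - h' = T (h - h').
  rewrite linearB_fun //; apply: (addIr (h' - T h)).
  by rewrite addrA subrK [RHS]addrC addrA subrK.
have := Tq (h - h'); rewrite -e; have := nm_ge0 (h - h').
set a := nm _ => a0 ha; have : (1 - q) * a <= 0 by rewrite mulrBl mul1r subr_le0.
by rewrite pmulr_rle0 ?subr_gt0 // => ?; apply/eqP; rewrite eq_le a0 andbT.
Qed.

Lemma neumann_le T (q : R) h : q < 1 -> (forall x, nm (T x) <= q * nm x) ->
  nm h <= nm (h - T h) / (1 - q).
Proof.
move=> q1 Tq; rewrite ler_pdivlMr ?subr_gt0 //.
have := nmD (h - T h) (T h); rewrite subrK; have := Tq h; lra.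
Qed.

End adjoint.

(** * Hilbert modules *)

Section module.
Context {R : realType} (d : nat) (H : hilbertType R) (M : hilbert_module d H).
Implicit Types (x y w : H) (z : Cn R d).
Local Notation nm := (snorm (@rdot R H)).
Local Notation D := (defect M).

Lemma realcX (a : R) n : (a ^+ n)%:C = a%:C ^+ n.
Proof. exact: rmorphXn. Qed.

Lemma realcM (a b : R) : (a * b)%:C = a%:C * b%:C.
Proof. exact: rmorphM. Qed.

Lemma realcD (a b : R) : (a + b)%:C = a%:C + b%:C.
Proof. exact: rmorphD. Qed.

Lemma realc_sum (I : Type) (s : seq I) (F : I -> R) :
  (\sum_(i <- s) F i)%:C = \sum_(i <- s) (F i)%:C.
Proof. exact: rmorph_sum. Qed.

Lemma conjCE (a b : R) : Num.conj (a +i* b) = a +i* (- b).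
Proof. by []. Qed.

Lemma cnorm_sqr z : cnorm z ^+ 2 = \sum_(k < d) ((tnth z k).1 ^+ 2 + (tnth z k).2 ^+ 2).
Proof. by rewrite sqr_sqrtr // sumr_ge0 // => k _; rewrite addr_ge0 ?sqr_ge0. Qed.

Lemma cnorm_ge0 z : 0 <= cnorm z. Proof. exact: sqrtr_ge0. Qed.

Lemma cnorm_rscale r z : 0 <= r -> cnorm (rscale r z) = r * cnorm z.
Proof.
move=> r0; apply/eqP; rewrite -(@eqrXn2 _ 2) ?mulr_ge0 ?cnorm_ge0 //.
rewrite exprMn !cnorm_sqr mulr_sumr; apply/eqP/eq_bigr => k _.
by rewrite tnth_mktuple /= !exprMn mulrDr.
Qed.

Lemma cnorm_zrot c s z : c ^+ 2 + s ^+ 2 = 1 -> cnorm (zrot c s z) = cnorm z.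
Proof.
move=> cs; rewrite /cnorm; congr Num.sqrt; apply: eq_bigr => k _.
by rewrite tnth_mktuple /prot /= -[RHS]mul1r -cs; ring.
Qed.

Lemma op_at_linear z : linear (op_at M z).
Proof.
move=> a x y; rewrite /op_at scaler_sumr -big_split; apply: eq_bigr => k _ /=.
by rewrite linearP scalerDr !scalerA mulrC.
Qed.

Lemma op_at_rscale r z x : op_at M (rscale r z) x = r%:C *: op_at M z x.
Proof.
rewrite /op_at scaler_sumr; apply: eq_bigr => k _; rewrite scalerA; congr (_ *: _).
rewrite /zcoord tnth_mktuple /=; case: (tnth z k) => a b /=.
by rewrite !conjCE; simpc.
Qed.

Lemma op_at_zrot th z x : op_at M (zrot (cos th) (sin th) z) x = cis (- th) *: op_at M z x.
Proof.
rewrite /op_at scaler_sumr; apply: eq_bigr => k _; rewrite scalerA; congr (_ *: _).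
rewrite -conj_cis -rmorphM; congr (Num.conj _).
by rewrite /zcoord tnth_mktuple /prot /cis /=; simpc; congr (_ +i* _); rewrite addrC.
Qed.

Lemma row_contractive (b : 'I_d -> H) :
  nm (\sum_k op M k (b k)) ^+ 2 <= \sum_k nm (b k) ^+ 2.
Proof.
have := op_contractive M b.
under [X in _ <= X]eq_bigr do rewrite normHE -rmorphXn /=.
by rewrite normHE -rmorphXn -rmorph_sum lecR.
Qed.

(** T(z) is the row of the operators applied to this column, so the norm of the column bounds
    T(z). *)
Lemma op_at_row z w : \sum_(k < d) nm (Num.conj (zcoord z k) *: w) ^+ 2 = (cnorm z * nm w) ^+ 2.
Proof.
rewrite exprMn cnorm_sqr mulr_suml; apply: eq_bigr => k _.
apply: complexI; rewrite realcX nmZ exprMn [RHS]realcM [X in _ = _ * X]realcX; congr (_ * _).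
rewrite norm_conjC sqr_normc /zcoord; case: (tnth z k) => a b.
by apply/eqP; rewrite eq_complex /=; apply/andP; split; apply/eqP; ring.
Qed.

Lemma op_at_le z x : nm (op_at M z x) <= cnorm z * nm x.
Proof.
rewrite -(@ler_pXn2r _ 2) ?nnegrE ?mulr_ge0 ?nm_ge0 ?cnorm_ge0 //.
rewrite -op_at_row /op_at.
under eq_bigr do rewrite -linearZ.
exact: row_contractive.
Qed.

Lemma op_le k x : nm (op M k x) <= 1 * nm x.
Proof.
rewrite mul1r -(@ler_pXn2r _ 2) ?nnegrE ?nm_ge0 //.
have := row_contractive (fun j => if j == k then x else 0).
rewrite (bigD1 k) //= eqxx big1 ?addr0; last by move=> j /negPf ->; rewrite linear0.
by rewrite (bigD1 k) //= eqxx big1 ?addr0 // => j /negPf ->; rewrite nm0 expr0n.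
Qed.

Lemma op_linear k : linear (op M k).
Proof. by move=> a x y; rewrite linearP. Qed.

(** Polarization: [s] is sesquilinear and vanishes on the diagonal because [hdot (T x) x] is real;
    the vectors [x + y] and [x + 'i *: y] then force it to vanish. *)
Lemma positive_op_sym (T : H -> H) : positive_op T -> forall x y, hdot (T x) y = hdot x (T y).
Proof.
move=> [linT _ T0]; pose s x y := hdot (T x) y - hdot x (T y).
have sxx x : s x x = 0.
  have := T0 x; rewrite /s [X in _ - X]hdotC lecE.
  by case: (hdot (T x) x) => a b /andP[/eqP /= -> _]; rewrite conjCE oppr0 subrr.
have sD x y x' y' : s (x + y) (x' + y') = s x x' + s x y' + (s y x' + s y y').
  by rewrite /s !(linearD_fun linT) !hdotDl !hdotDr; ring.
have sZl a x y : s (a *: x) y = a * s x y.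
  by rewrite /s (linearZ_fun linT) !hdotZl mulrBr.
have sZr a x y : s x (a *: y) = Num.conj a * s x y.
  by rewrite /s (linearZ_fun linT) !hdotZr mulrBr.
move=> x y; apply/eqP; rewrite -subr_eq0 -/(s x y); apply/eqP.
have h1 : s x y + s y x = 0.
  by have := sxx (x + y); rewrite sD !sxx add0r addr0.
have h2 : s x y - s y x = 0.
  have := sxx (x + 'i%C *: y); rewrite sD sZl !sZr sZl !sxx mulr0 mulr0 add0r addr0.
  have -> : Num.conj ('i%C : R[i]) = - 'i%C by rewrite conjCE; simpc.
  rewrite mulNr -[- (_ * _)]mulrN -mulrDr => /eqP; rewrite mulf_eq0 => /orP[|/eqP h].
    by rewrite eq_complex /= oner_eq0 andbF.
  by apply/eqP; rewrite -oppr_eq0 opprB addrC h.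
have : 2 * s x y = 0.
  have -> : 2 * s x y = (s x y + s y x) + (s x y - s y x) by ring.
  by rewrite h1 h2 addr0.
by move/eqP; rewrite mulf_eq0 pnatr_eq0 => /eqP.
Qed.

(* If there were no positive square root, [op_sqrt] would be [0], for which the claims
   hold too: so its existence is not needed. *)
Lemma defect_spec : linear D /\ (forall x y, hdot (D x) y = hdot x (D y)) /\
  forall a (b : 'I_d -> H),
    nm (D a + \sum_k op M k (b k)) ^+ 2 <= nm a ^+ 2 + \sum_k nm (b k) ^+ 2.
Proof.
rewrite /defect /op_sqrt; set P := (X in xget _ X).
have [[S PS]|nS] := pselect (exists S, P S); last first.
  rewrite xgetPN; last by move=> S PS; apply: nS; exists S.
  split; first by move=> a x y; rewrite /= scaler0 addr0.
  split; first by move=> x y; rewrite [RHS]hdotC /= !hdot0l rmorph0.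
  move=> a b; rewrite /= add0r; apply: le_trans (row_contractive b) _.
  by rewrite lerDr sqr_ge0.
have [] := xgetI (cst 0) PS; move: (xget _ _) => S' S'pos S'2 {S PS}.
have [linS _ _] := S'pos; have symS := positive_op_sym S'pos.
split => //; split => // a b.
set y := _ + _.
have adj k := adjointP (op_linear k) (op_le k).
(* The adjoint column of the row is isometric; the claim on the row follows by pairing [y] with
   itself and using Young's inequality. *)
have sq : nm (S' y) ^+ 2 + \sum_k nm (adjoint (op M k) y) ^+ 2 = nm y ^+ 2.
  apply: complexI; rewrite realcD realc_sum nm_sqr rdot_sqr -symS.
  have -> : S' (S' y) = y - \sum_(k < d) op M k (adjoint (op M k) y).
    by move/(congr1 (fun f => f y)) : S'2.
  rewrite nm_sqr rdot_sqr hdotBl hdot_suml.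
  under [X in _ + X]eq_bigr do rewrite nm_sqr rdot_sqr -adj.
  by rewrite subrK.
have E : rdot y y = rdot a (S' y) + \sum_k rdot (b k) (adjoint (op M k) y).
  rewrite {1}/y rdotDl (form_suml (@rdotDl R H) (@rdotZl R H)) /rdot symS.
  by congr (_ + _); apply: eq_bigr => k _; rewrite adj.
have young u w : 2 * rdot u w <= nm u ^+ 2 + nm w ^+ 2.
  by have := rdot_CS u w; have := sqr_ge0 (nm u - nm w); rewrite sqrrB; lra.
have h : 2 * rdot y y <= (nm a ^+ 2 + \sum_k nm (b k) ^+ 2) + nm y ^+ 2.
  rewrite E -sq mulrDr mulr_sumr addrACA -big_split /=; apply: lerD => //.
  by apply: ler_sum.
by move: h; rewrite -nm_sqr; lra.
Qed.

End module.

(** * The energy of a vector and its Hardy space function *)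

Section curvature.
Context {R : realType} (d : nat) (H : hilbertType R) (M : hilbert_module d H).
Implicit Types (x y w xi : H) (z : Cn R d).
Local Notation nm := (snorm (@rdot R H)).
Local Notation D := (defect M).

Definition resolvent z x : H := pinv setT (fun y => y - op_at M z y) x.

Lemma resolventP z x : cnorm z < 1 -> resolvent z x - op_at M z (resolvent z x) = x.
Proof.
move=> z1; have z01 : 0 <= cnorm z < 1 by rewrite cnorm_ge0.
have [h [hE _]] := neumann x z01 (@op_at_linear _ _ _ M z) (op_at_le M z).
rewrite /resolvent; apply: (@pinvK _ _ _ _ (fun y => y - op_at M z y)).
by rewrite inE; exists h.
Qed.

Lemma resolvent_cvg z x : cnorm z < 1 ->
  nm (\sum_(0 <= k < n) iter k (op_at M z) x - resolvent z x) @[n --> \oo] --> 0.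
Proof.
move=> z1; have z01 : 0 <= cnorm z < 1 by rewrite cnorm_ge0.
have [h [hE hc]] := neumann x z01 (@op_at_linear _ _ _ M z) (op_at_le M z).
suff -> : resolvent z x = h by [].
apply: (neumann_unique z1 (@op_at_linear _ _ _ M z) (op_at_le M z)).
by rewrite resolventP.
Qed.

(** The inverse of the adjoint of [1 - T(z)] is the adjoint of the resolvent, so F(z) has the form
    [X^* X] with [X] the resolvent after [D]. *)
Lemma F_opE z xi xi' : cnorm z < 1 ->
  hdot (F_op M z xi) xi' = hdot (resolvent z (D xi)) (resolvent z (D xi')).
Proof.
move=> z1; have [linD [symD _]] := defect_spec M.
have z01 : 0 <= cnorm z < 1 by rewrite cnorm_ge0.
have linA := @op_at_linear _ _ _ M z; have leA := op_at_le M z.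
have adjA := adjointP linA leA.
have linA' := adjoint_linear linA leA.
have leA' := adjoint_le (cnorm_ge0 z) linA leA.
rewrite /F_op -/(resolvent z (D xi)); set h := resolvent z (D xi).
set k := pinv setT _ h.
have kE : k - adjoint (op_at M z) k = h.
  have [h' [h'E _]] := neumann h z01 linA' leA'.
  apply: (@pinvK _ _ _ _ (fun y => y - adjoint (op_at M z) y)).
  by rewrite inE; exists h'.
rewrite symD -{1}(resolventP (D xi') z1); set h2 := resolvent z (D xi').
by rewrite hdotBr [X in _ - X]hdotC adjA -[X in _ - X]hdotC -hdotBl kE.
Qed.

(** By [F_opE] this is the share of [xi] in the trace when [xi] belongs to an orthonormal basis. *)
Definition energy z xi r := (1 - r ^+ 2) * nm (resolvent (rscale r z) (D xi)) ^+ 2.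

(* The form is [|p|^2 - |W p|^2] for the row contraction [W = (Delta, S)]. *)
Definition defect_form (S : H -> H) (p q : (H * H)%type) : R :=
  rdot p.1 q.1 + rdot p.2 q.2 - rdot (D p.1 + S p.2) (D q.1 + S q.2).

Section slice.
Variable z : Cn R d.
Hypothesis z1 : cnorm z = 1.
Local Notation S := (op_at M z).
Local Notation B := (defect_form S).

Lemma dformC p q : B p q = B q p.
Proof. by rewrite /defect_form !(rdotC q.1) !(rdotC q.2) (rdotC (D q.1 + _)). Qed.

Lemma dformDl p p' q : B (p + p') q = B p q + B p' q.
Proof.
have [linD _] := defect_spec M.
rewrite /defect_form /= (linearD_fun linD) (linearD_fun (@op_at_linear _ _ _ M z)).
rewrite addrACA !rdotDl; ring.
Qed.

Lemma dformZl (a : R) p q : B (a%:C *: p) q = a * B p q.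
Proof.
have [linD _] := defect_spec M.
rewrite /defect_form /= (linearZ_fun linD) (linearZ_fun (@op_at_linear _ _ _ M z)).
rewrite -scalerDr !rdotZl; ring.
Qed.

Lemma dform_cis t p q : B (cis t *: p) (cis t *: q) = B p q.
Proof.
have [linD _] := defect_spec M.
rewrite /defect_form /= !(linearZ_fun linD) !(linearZ_fun (@op_at_linear _ _ _ M z)).
by rewrite -!scalerDr !rdot_cis.
Qed.

(** This is the row contraction at the column with entries [conj z_k *: p.2], whose norm is that of
    [p.2] because [z] is a unit vector. *)
Lemma dform_ge0 p : 0 <= B p p.
Proof.
have [_ [_ row]] := defect_spec M.
have := row p.1 (fun k => Num.conj (zcoord z k) *: p.2).
rewrite op_at_row z1 mul1r; under eq_bigr do rewrite linearZ.
by rewrite -/(op_at M z p.2) !nm_sqr /defect_form subr_ge0.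
Qed.

Variable xi : H.

(** The coefficients of [phi]: the Neumann series of the resolvent, shifted by one because of the
    factor [conj l] in front of it. *)
Definition dseq n : (H * H)%type :=
  if n is n'.+1 then (0, iter n' S (D xi)) else (xi, 0).

(** With [l = r * cis th], the operator [conj l *: S] is T at the rotated and scaled point, see
    [op_at_rz]; hence the resolvent is taken there. *)
Definition dphi (r th : R) : (H * H)%type :=
  (xi, (r%:C * cis (- th)) *: resolvent (rscale r (zrot (cos th) (sin th) z)) (D xi)).

Lemma cnorm_rz r th : 0 <= r < 1 -> cnorm (rscale r (zrot (cos th) (sin th) z)) < 1.
Proof.
move=> /andP[r0 r1]; rewrite cnorm_rscale // cnorm_zrot ?z1 ?mulr1 //.
exact: cos2Dsin2.
Qed.

Lemma op_at_rz r th x :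
  op_at M (rscale r (zrot (cos th) (sin th) z)) x = (r%:C * cis (- th)) *: S x.
Proof. by rewrite op_at_rscale op_at_zrot scalerA. Qed.

Lemma dform_dphi r th : 0 <= r < 1 ->
  B (dphi r th) (dphi r th) = nm xi ^+ 2 - energy (zrot (cos th) (sin th) z) xi r.
Proof.
move=> r01; rewrite /defect_form /energy /=; set h := resolvent _ _.
have hE := resolventP (D xi) (cnorm_rz th r01); rewrite -/h in hE.
rewrite (linearZ_fun (@op_at_linear _ _ _ M z)) -op_at_rz.
rewrite -{1 2}hE subrK -!nm_sqr.
have -> : nm ((r%:C * cis (- th)) *: h) = r * nm h.
  rewrite -scalerA (snormZ (@rdotC R H) (@rdotZl R H)) ger0_norm; last by case/andP: r01.
  by rewrite (snorm_cis (@rdot_cis R H)).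
ring.
Qed.

(** The row sends [dseq n] to the second component of [dseq n.+1], which is why consecutive terms
    cancel. *)
Lemma dseq_sum K : \sum_(0 <= n < K) B (dseq n) (dseq n) <= nm xi ^+ 2.
Proof.
have [linD _] := defect_spec M; have linS := @op_at_linear _ _ _ M z.
have E : forall K, \sum_(0 <= n < K.+1) B (dseq n) (dseq n) =
    nm xi ^+ 2 - nm (iter K S (D xi)) ^+ 2.
  elim=> [|k IH]; rewrite big_nat_recr //=.
    rewrite big_geq // add0r /defect_form /= (linear0_fun linS) addr0.
    by rewrite -!nm_sqr nm0 expr0n addr0.
  rewrite IH /defect_form /= (linear0_fun linD) add0r -!nm_sqr nm0 expr0n /=; ring.
case: K => [|K]; first by rewrite big_geq // sqr_ge0.
by rewrite E lerBlDr lerDl sqr_ge0.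
Qed.

Lemma snorm_dform_le y : snorm B (0, y) <= nm y.
Proof.
have [linD _] := defect_spec M.
rewrite -(@ler_pXn2r _ 2) ?nnegrE ?snorm_ge0 ?nm_ge0 // (snorm_sqr dform_ge0).
rewrite /defect_form /= -!nm_sqr nm0 expr0n add0r lerBlDr lerDl sqr_ge0 //.
Qed.

Lemma iter_op_at_rz r th n x :
  iter n (op_at M (rscale r (zrot (cos th) (sin th) z))) x =
  ((r ^+ n)%:C * cis (- (n%:R * th))) *: iter n S x.
Proof.
elim: n => [|n IH]; first by rewrite mul0r oppr0 cis0 !mulr1 scale1r.
rewrite !iterS IH op_at_rz (linearZ_fun (@op_at_linear _ _ _ M z)) scalerA; congr (_ *: _).
rewrite mulrACA -cisD -rmorphM -exprS; congr (_ * cis _).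
by rewrite -natr1; ring.
Qed.

Lemma dphi_cvg r th : 0 <= r < 1 ->
  snorm B (dphi r th - pow_sum dseq 0 K r th) @[K --> \oo] --> 0.
Proof.
move=> r01; have /andP[r0 r1] := r01.
set zz := rscale r (zrot (cos th) (sin th) z); set h := resolvent zz (D xi).
have hc := resolvent_cvg (D xi) (cnorm_rz th r01); rewrite -/zz -/h in hc.
(* [K.+1] coefficients of [dseq] match [K] terms of the Neumann series. *)
rewrite -(cvg_shiftS (fun K => snorm B (dphi r th - pow_sum dseq 0 K r th))) /=.
apply: (squeeze_cvgr _ (cvg_cst (0 : R)) hc); apply: nearW => K.
rewrite snorm_ge0 /=.
pose l := r%:C * cis (- th).
have -> : dphi r th - pow_sum dseq 0 K.+1 r th =
    (0, l *: (h - \sum_(0 <= k < K) iter k (op_at M zz) (D xi))).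
  rewrite /pow_sum big_nat_recl // mul0r oppr0 cis0 expr0 !scale1r.
  have -> : \sum_(0 <= i < K) (r ^+ i.+1)%:C *: (cis (- (i.+1%:R * th)) *: dseq i.+1) =
      (0, l *: \sum_(0 <= k < K) iter k (op_at M zz) (D xi)).
    rewrite scaler_sumr; elim: K => [|K IH]; first by rewrite !big_geq.
    rewrite !big_nat_recr //= IH iter_op_at_rz.
    have E (a : R[i]) (u v w : H) : (u, v) + a *: (0, w) = (u, v + a *: w) :> (H * H)%type.
      transitivity (u + a *: (0 : H), v + a *: w); first by [].
      by rewrite scaler0 addr0.
    rewrite scalerA E; congr (_, _ + _); rewrite scalerA; congr (_ *: _).
    rewrite /l mulrACA -cisD -rmorphM -exprS; congr (_ * cis _).
    by rewrite -natr1; ring.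
  rewrite /dphi /= -/zz -/h -/l scalerBr.
  by congr pair; rewrite /= ?addr0 ?subrr ?add0r.
apply: le_trans (snorm_dform_le _) _.
rewrite -scalerA (snormZ (@rdotC R H) (@rdotZl R H)) (snorm_cis (@rdot_cis R H)).
rewrite ger0_norm // -nmN opprB -[leRHS]mul1r ler_wpM2r ?nm_ge0 // ltW //.
Qed.

Lemma energy_slice : (@lebesgue_measure R).-negligible
  [set th : R | -1 <= th <= 1 /\ ~ left_cauchy (energy (zrot (cos th) (sin th) z) xi)].
Proof.
have := fatou_hardy dformC dformDl dformZl dform_cis dform_ge0 dseq_sum dphi_cvg.
apply: negligibleS => th /= [thb nc]; split => // c; apply: nc => k.
have [m hm] := c k; exists m => r s rb sb.
have m1 : m.+1%:R^-1 <= 1 :> R by rewrite invf_le1 // ler1n.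
have r01 : 0 <= r < 1 by move: (m.+1%:R^-1) m1 rb => q; lra.
have s01 : 0 <= s < 1 by move: (m.+1%:R^-1) m1 sb => q; lra.
have := hm r s rb sb; rewrite !dform_dphi //.
by rewrite opprB addrC subrKA distrC.
Qed.

End slice.

Lemma energy_le z xi r : cnorm z = 1 -> 0 <= r < 1 -> energy z xi r <= nm xi ^+ 2.
Proof.
move=> z1 r01; have := dform_ge0 z1 (dphi z xi r 0).
rewrite dform_dphi // cos0 sin0 subr_ge0.
suff -> : zrot 1 0 z = z by [].
apply/eq_from_tnth => k; rewrite tnth_mktuple /prot.
by case: (tnth z k) => a b /=; rewrite !mul0r !mul1r subr0 add0r.
Qed.

Lemma energy_ge0 z xi r : 0 <= r < 1 -> 0 <= energy z xi r.
Proof.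
move=> /andP[r0 r1]; rewrite mulr_ge0 ?sqr_ge0 // subr_ge0 expr_le1 // ltW //.
Qed.

End curvature.

(** * Traces in orthonormal bases *)

Section trace.
Context {R : realType} (d : nat) (H : hilbertType R) (M : hilbert_module d H).
Implicit Types (x y w xi : H) (z : Cn R d).
Local Notation nm := (snorm (@rdot R H)).
Local Notation D := (defect M).

(** Expand one factor in [f], exchange the sums and collect in [e]. The two bases may differ in
    size, so that [T = id] shows the dimension to be well defined. *)
Lemma onb_trace (V : set H) n m (e : 'I_n -> H) (f : 'I_m -> H) (T : H -> H) :
  orthonormal_basis V e -> orthonormal_basis V f -> linear T ->
  \sum_i hdot (T (e i)) (T (e i)) = \sum_j hdot (T (f j)) (T (f j)).
Proof.
move=> [eV _ eE] [fV _ fE] linT.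
transitivity (\sum_i \sum_j hdot (e i) (f j) * hdot (T (f j)) (T (e i))).
  apply: eq_bigr => i _; rewrite {1}(fE _ (eV i)) (linear_sum_fun linT) hdot_suml.
  by apply: eq_bigr => j _; rewrite (linearZ_fun linT) hdotZl.
rewrite exchange_big /=; apply: eq_bigr => j _.
rewrite [X in hdot _ (T X)](eE _ (fV j)) (linear_sum_fun linT) hdot_sumr.
by apply: eq_bigr => i _; rewrite (linearZ_fun linT) hdotZr -hdotC.
Qed.

Lemma dimension_onb (V : set H) n (e : 'I_n -> H) : orthonormal_basis V e -> dimension V = n.
Proof.
move=> eV; have [f fV] : has_dimension V (dimension V).
  by apply: (@xgetI _ 0 [set n | has_dimension V n] n); exists e.
have := onb_trace fV eV (T := id) _.
case: fV eV => [_ fo _] [_ eo _] /(_ (fun _ _ _ => erefl)).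
under eq_bigr do rewrite fo eqxx; under [RHS]eq_bigr do rewrite eo eqxx.
by rewrite !sumr_const !card_ord => /eqP; rewrite eqr_nat => /eqP.
Qed.

Lemma resolvent_linear z : cnorm z < 1 -> linear (fun x => resolvent M z (D x)).
Proof.
move=> z1 a x y; have [linD _] := defect_spec M.
have linA := @op_at_linear _ _ _ M z.
apply: (neumann_unique z1 linA (op_at_le M z)).
rewrite resolventP // linA [RHS](_ : _ = a *: (resolvent M z (D x) - op_at M z (resolvent M z (D x)))
  + (resolvent M z (D y) - op_at M z (resolvent M z (D y)))).
  by rewrite !resolventP // linD.
by rewrite scalerBr opprD addrACA.
Qed.

Lemma curvature_funE n (e : 'I_n -> H) z r : orthonormal_basis (defect_space M) e ->
  cnorm z = 1 -> 0 <= r < 1 ->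
  curvature_fun M z r = (\sum_i energy M z (e i) r)%:C.
Proof.
move=> eV z1 /andP[r0 r1]; have zr1 : cnorm (rscale r z) < 1.
  by rewrite cnorm_rscale // z1 mulr1.
rewrite /curvature_fun /energy -mulr_sumr realcM; congr (_ * _).
rewrite /trace.
have [k [f [fV ->]]] := @xgetI _ (0 : R[i]) [set t | exists n (e : 'I_n -> H),
  orthonormal_basis (defect_space M) e /\ t = \sum_i hdot (F_op M (rscale r z) (e i)) (e i)] _
  (ex_intro _ n (ex_intro _ e (conj eV erefl))).
rewrite realc_sum; under eq_bigr do rewrite F_opE //.
rewrite (onb_trace fV eV (resolvent_linear zr1)).
by apply: eq_bigr => i _; rewrite nm_sqr rdot_sqr.
Qed.

End trace.

(** * Continuity in the radius *)

Section continuity.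
Context {R : realType} (d : nat) (H : hilbertType R) (M : hilbert_module d H).
Implicit Types (x y w xi : H) (z : Cn R d).
Local Notation nm := (snorm (@rdot R H)).
Local Notation D := (defect M).

(** By the resolvent identity, [h p - h r] solves the equation at radius [p] with right side
    [(p - r) S (h r)], and [neumann_le] bounds the solution. This is what allows restriction to
    rational radii. *)
Lemma energy_continuous z xi (r : R) : cnorm z <= 1 -> 0 < r < 1 ->
  energy M z xi p @[p --> r] --> energy M z xi r.
Proof.
move=> z1 /andP[r0 r1]; rewrite /energy.
have zp p : 0 < p < 1 -> cnorm (rscale p z) < 1.
  move=> /andP[p0 p1]; rewrite cnorm_rscale ?(ltW p0) //.
  by apply: le_lt_trans p1; rewrite -[leRHS]mulr1 ler_wpM2l // ltW.
have r01 : 0 < r < 1 by rewrite r0.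
pose h p := resolvent M (rscale p z) (D xi).
pose C := nm (op_at M z (h r)).
have hp p : 0 < p < 1 -> `|nm (h r) - nm (h p)| <= `|r - p| * (C / (1 - p)).
  move=> p01; apply: le_trans (nm_dist _ _) _; rewrite -nmN opprB.
  have /andP[p0 p1] := p01.
  have lep x : nm (op_at M (rscale p z) x) <= p * nm x.
    apply: le_trans (op_at_le M _ _) _; rewrite ler_wpM2r ?nm_ge0 //.
    by rewrite cnorm_rscale ?(ltW p0) // -[leRHS]mulr1 ler_wpM2l // ltW.
  apply: le_trans (neumann_le _ p1 lep) _.
  rewrite mulrA ler_wpM2r ?invr_ge0 ?subr_ge0 ?(ltW p1) //.
  have -> : h p - h r - op_at M (rscale p z) (h p - h r) = (p - r)%:C *: op_at M z (h r).
    rewrite (linearB_fun (@op_at_linear _ _ _ M _)) opprD opprK addrACA.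
    have hpE := resolventP M (D xi) (zp _ p01); rewrite -/(h p) in hpE.
    have hrE := resolventP M (D xi) (zp _ r01); rewrite -/(h r) in hrE.
    rewrite hpE -[X in X + _]hrE addrACA subrr add0r addrC !op_at_rscale.
    by rewrite rmorphB scalerBl.
  by rewrite (snormZ (@rdotC R H) (@rdotZl R H)) distrC.
have hc : nm (h p) @[p --> r] --> nm (h r).
  have c1 : `|r - p| * (C / (1 - p)) @[p --> r] --> `|r - r| * (C / (1 - r)).
    apply: cvgM; first by apply: cvg_norm; apply: cvgB; [exact: cvg_cst|exact: cvg_id].
    apply: cvgM; first exact: cvg_cst.
    apply: cvgV; first by rewrite subr_eq0 gt_eqF.
    by apply: cvgB; [exact: cvg_cst|exact: cvg_id].
  rewrite subrr normr0 mul0r in c1.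
  apply/cvgrPdist_le => e e0.
  move/cvgrPdist_le : c1 => /(_ _ e0) c1.
  have N : \forall p \near r, 0 < p < 1.
    by near=> p; apply/andP; split; near: p; [exact: lt_nbhsr|exact: lt_nbhsl].
  near=> p.
  have p01 : 0 < p < 1 by near: p.
  have c1p : `|0 - `|r - p| * (C / (1 - p))| <= e by near: p.
  apply: le_trans (hp p p01) _; apply: le_trans c1p.
  by rewrite sub0r normrN ler_norm.
apply: cvgM; first by apply: cvgB; [exact: cvg_cst|exact: exprn_continuous].
by rewrite !expr2; under eq_fun do rewrite expr2; apply: cvgM.
Unshelve. all: by end_near. Qed.

End continuity.

(** * Measurability of the exceptional set *)

Section measurability.
Context {R : realType} (d : nat) (H : hilbertType R) (M : hilbert_module d H).
Implicit Types (x y w xi : H) (z : Cn R d).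
Local Notation nm := (snorm (@rdot R H)).
Local Notation D := (defect M).
Local Notation RT := (measurableTypeR R).

Definition cmeas (f : Cn R d -> R[i]) :=
  measurable_fun setT (fun z => complex.Re (f z) : RT) /\
  measurable_fun setT (fun z => complex.Im (f z) : RT).

Lemma cmeasD f g : cmeas f -> cmeas g -> cmeas (fun z => f z + g z).
Proof.
move=> [f1 f2] [g1 g2]; split.
  rewrite (_ : (fun _ => _) = fun z => complex.Re (f z) + complex.Re (g z)).
    exact: measurable_funD.
  by apply/funext => z; case: (f z) (g z) => ? ? [].
rewrite (_ : (fun _ => _) = fun z => complex.Im (f z) + complex.Im (g z)).
  exact: measurable_funD.
by apply/funext => z; case: (f z) (g z) => ? ? [].
Qed.

Lemma cmeasM f g : cmeas f -> cmeas g -> cmeas (fun z => f z * g z).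
Proof.
move=> [f1 f2] [g1 g2]; split.
  rewrite (_ : (fun _ => _) = fun z => complex.Re (f z) * complex.Re (g z) -
    complex.Im (f z) * complex.Im (g z)).
    by apply: measurable_funB; exact: measurable_funM.
  by apply/funext => z; case: (f z) (g z) => ? ? [].
rewrite (_ : (fun _ => _) = fun z => complex.Re (f z) * complex.Im (g z) +
    complex.Im (f z) * complex.Re (g z)).
  by apply: measurable_funD; exact: measurable_funM.
by apply/funext => z; case: (f z) (g z) => ? ? [].
Qed.

Lemma cmeas_cst a : cmeas (fun=> a).
Proof. by split; exact: measurable_cst. Qed.

Lemma cmeas_conj f : cmeas f -> cmeas (fun z => Num.conj (f z)).
Proof.
move=> [f1 f2]; split.
  by rewrite (_ : (fun _ => _) = fun z => complex.Re (f z)) //;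
     apply/funext => z; case: (f z).
rewrite (_ : (fun _ => _) = fun z => -1 * complex.Im (f z)).
  by apply: measurable_funM => //; exact: measurable_cst.
by apply/funext => z; case: (f z) => a b; rewrite conjCE /= mulN1r.
Qed.

Lemma cmeas_sum (I : Type) (s : seq I) (f : I -> Cn R d -> R[i]) :
  (forall i, cmeas (f i)) -> cmeas (fun z => \sum_(i <- s) f i z).
Proof.
move=> mf; elim: s => [|i s IH].
  by under eq_fun do rewrite big_nil; exact: cmeas_cst.
by under eq_fun do rewrite big_cons; exact: cmeasD.
Qed.

Lemma cmeas_zcoord k : cmeas (fun z => zcoord z k).
Proof.
split; rewrite /zcoord /=.
  by apply: (measurableT_comp (f := fst)) => //; exact: measurable_tnth.
by apply: (measurableT_comp (f := snd)) => //; exact: measurable_tnth.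
Qed.

(** Only scalar functions of [z] are considered: these are polynomials in the coordinates and their
    conjugates. The innermost factor is expanded first, so that the operators act on vectors
    independent of [z]. *)
Lemma cmeas_iter n m x y :
  cmeas (fun z => hdot (iter n (op_at M z) x) (iter m (op_at M z) y)).
Proof.
have iterlin k z : linear (iter k (op_at M z)).
  elim: k => [|k IH] a u v //=; rewrite IH; exact: op_at_linear.
elim: n x => [|n IHn] x.
  elim: m y => [|m IHm] y; first exact: (cmeas_cst (hdot x y)).
  rewrite (_ : (fun _ => _) = fun z => \sum_k zcoord z k * hdot x (iter m (op_at M z) (op M k y))).
    by apply: cmeas_sum => k; apply: cmeasM; [exact: cmeas_zcoord|exact: IHm].
  apply/funext => z; rewrite iterSr /= {1}/op_at (linear_sum_fun (iterlin _ _)) hdot_sumr.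
  by apply: eq_bigr => k _; rewrite (linearZ_fun (iterlin _ _)) hdotZr conjCK.
rewrite (_ : (fun _ => _) = fun z => \sum_k Num.conj (zcoord z k) *
    hdot (iter n (op_at M z) (op M k x)) (iter m (op_at M z) y)).
  apply: cmeas_sum => k; apply: cmeasM; last exact: IHn.
  by apply: cmeas_conj; exact: cmeas_zcoord.
apply/funext => z; rewrite iterSr {1}/op_at (linear_sum_fun (iterlin _ _)) hdot_suml.
by apply: eq_bigr => k _; rewrite (linearZ_fun (iterlin _ _)) hdotZl.
Qed.

Lemma measurable_partial_sum N x : measurable_fun setT
  (fun z => rdot (\sum_(0 <= k < N) iter k (op_at M z) x)
                 (\sum_(0 <= k < N) iter k (op_at M z) x) : RT).
Proof.
suff [] : cmeas (fun z => hdot (\sum_(0 <= k < N) iter k (op_at M z) x)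
                 (\sum_(0 <= k < N) iter k (op_at M z) x)) by [].
under eq_fun do rewrite hdot_suml.
apply: cmeas_sum => n; under eq_fun do rewrite hdot_sumr.
by apply: cmeas_sum => m; exact: cmeas_iter.
Qed.

Lemma measurable_rscale r : measurable_fun setT (@rscale R d r).
Proof.
apply/measurable_fun_tnthP => k.
rewrite (_ : _ \o _ = fun z : Cn R d => (r * (tnth z k).1, r * (tnth z k).2)); last first.
  by apply/funext => z /=; rewrite tnth_mktuple.
apply: measurable_fun_pair; apply: measurable_funM => //.
  by apply: (measurableT_comp (f := fst)) => //; exact: measurable_tnth.
by apply: (measurableT_comp (f := snd)) => //; exact: measurable_tnth.
Qed.

Lemma cnorm_radial_le z : cnorm (radial z) <= 1.
Proof.
rewrite /radial cnorm_rscale ?invr_ge0 ?cnorm_ge0 //.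
(* At the origin [radial] is 0, whence an inequality in place of equality. *)
by have [->|z0] := eqVneq (cnorm z) 0; [rewrite mulr0|rewrite mulVf].
Qed.

Lemma radial_id z : cnorm z = 1 -> radial z = z.
Proof.
move=> z1; apply/eq_from_tnth => k; rewrite tnth_mktuple z1 invr1 !mul1r.
by case: (tnth z k).
Qed.

(** After [radial] and scaling by [r], every point of C^d lands in the open ball, so the energy is
    everywhere a limit of measurable partial sums. *)
Lemma measurable_energy xi r : 0 <= r < 1 ->
  measurable_fun setT (fun z => energy M (radial z) xi r : RT).
Proof.
move=> /andP[r0 r1]; apply: measurable_funM; first exact: measurable_cst.
pose rho z := rscale r (radial z).
have rho1 z : cnorm (rho z) < 1.
  rewrite cnorm_rscale //; apply: le_lt_trans r1.
  by rewrite -[leRHS]mulr1 ler_wpM2l // cnorm_radial_le.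
have mrho : measurable_fun setT rho.
  by apply: measurableT_comp; [exact: measurable_rscale|exact: measurable_radial].
pose s N z := \sum_(0 <= k < N) iter k (op_at M (rho z)) (D xi).
apply: (@measurable_fun_cvg _ _ _ setT (fun N z => rdot (s N z) (s N z) : RT)) => //.
  by move=> N; apply: (measurableT_comp (measurable_partial_sum N (D xi)) mrho).
move=> z _; under eq_fun do rewrite -nm_sqr expr2.
have c : nm (s N z) @[N --> \oo] --> nm (resolvent M (rho z) (D xi)).
  have := resolvent_cvg M (D xi) (rho1 z); rewrite -/(s _ z) => /cvgrPdist_le h.
  apply/cvgrPdist_le => e e0; move: (h e e0); apply: filterS => n.
  rewrite sub0r normrN ger0_norm ?nm_ge0 // => h2.
  by apply: le_trans h2; rewrite distrC; exact: nm_dist.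
by rewrite expr2; exact: cvgM.
Qed.

(** Indices that code no rational are sent to 0, so the range is exactly the rationals. *)
Definition rat_enum (i : nat) : R := ratr (odflt (0%Q : rat) (unpickle i)).

Lemma rat_enum_dense (a b : R) : a < b -> exists i, a < rat_enum i < b.
Proof.
move=> /rat_in_itvoo [q]; rewrite in_itv /= => qab.
by exists (pickle q); rewrite /rat_enum pickleK.
Qed.

(* Countably many conditions, so that exceptional sets are measurable. *)
Definition rat_cauchy (g : R -> R) := forall k : nat, exists m : nat, forall i j : nat,
  1 - m.+1%:R^-1 < rat_enum i < 1 -> 1 - m.+1%:R^-1 < rat_enum j < 1 ->
  `|g (rat_enum i) - g (rat_enum j)| <= k.+1%:R^-1.

Lemma left_rat_cauchy g : left_cauchy g -> rat_cauchy g.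
Proof. by move=> h k; have [m hm] := h k; exists m => i j; exact: hm. Qed.

Lemma rat_left_cauchy (g : R -> R) :
  (forall r : R, 0 < r < 1 -> g p @[p --> r] --> g r) -> rat_cauchy g -> left_cauchy g.
Proof.
move=> cg h k; have [m hm] := h k; exists m => r s rb sb.
have m1 : m.+1%:R^-1 <= 1 :> R by rewrite invf_le1 // ler1n.
move: (m.+1%:R^-1) m1 hm rb sb => q q1 hm rb sb.
apply/ler_addgt0Pr => e e0.
have near t : 1 - q < t < 1 -> exists2 i, 1 - q < rat_enum i < 1 & `|g t - g (rat_enum i)| <= e / 2.
  move=> tb; have t01 : 0 < t < 1 by lra.
  have e20 : 0 < e / 2 by rewrite divr_gt0.
  have /cvgrPdist_le /(_ _ e20) [dl /= dl0 hdl] := cg t t01.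
  (* A rational below [t] stays below 1; the maximum keeps it in the given interval and within [dl]
     of [t]. *)
  have [|i /andP[i1 i2]] := @rat_enum_dense (Num.max (1 - q) (t - dl)) t.
    by rewrite gt_max; apply/andP; split; [by case/andP: tb|lra].
  move: i1; rewrite gt_max => /andP[i1 i3].
  exists i; first by rewrite i1 (lt_trans i2) //; case/andP: tb.
  by apply: hdl => /=; rewrite ger0_norm ?subr_ge0 ?(ltW i2) // ltrBlDr addrC -ltrBlDr.
have [i ib hi] := near r rb; have [j jb hj] := near s sb.
have := hm i j ib jb; move: hi hj; rewrite !ler_norml.
move: (k.+1%:R^-1) (g r) (g s) (g (rat_enum i)) (g (rat_enum j)) => c x y u w; lra.
Qed.

Lemma measurable_rat_cauchy (G : R -> Cn R d -> R) :
  (forall r, 0 <= r < 1 -> measurable_fun setT (G r : Cn R d -> RT)) ->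
  measurable [set z | ~ rat_cauchy (G ^~ z)].
Proof.
move=> mG.
rewrite (_ : [set z | _] = ~` (\bigcap_k \bigcup_m \bigcap_i \bigcap_j
  [set z | 1 - m.+1%:R^-1 < rat_enum i < 1 -> 1 - m.+1%:R^-1 < rat_enum j < 1 ->
     `|G (rat_enum i) z - G (rat_enum j) z| <= k.+1%:R^-1])).
  apply: measurableC; apply: bigcapT_measurable => k; apply: bigcupT_measurable => m.
  apply: bigcapT_measurable => i; apply: bigcapT_measurable => j.
  have [ib|ib] := pselect (1 - m.+1%:R^-1 < rat_enum i < 1); last first.
    by rewrite (_ : [set z | _] = setT) //; apply/seteqP; split => // z _ h; case: (ib h).
  have [jb|jb] := pselect (1 - m.+1%:R^-1 < rat_enum j < 1); last first.
    by rewrite (_ : [set z | _] = setT) //; apply/seteqP; split => // z _ _ h; case: (jb h).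
  have m1 : m.+1%:R^-1 <= 1 :> R by rewrite invf_le1 // ler1n.
  have i01 : 0 <= rat_enum i < 1 by move: (m.+1%:R^-1) m1 ib => q; lra.
  have j01 : 0 <= rat_enum j < 1 by move: (m.+1%:R^-1) m1 jb => q; lra.
  pose g z : RT := `|G (rat_enum i) z - G (rat_enum j) z|.
  have mg : measurable_fun setT g.
    apply: (measurableT_comp (f := (fun x : RT => `|x|))); first exact: normr_measurable.
    by apply: measurable_funB; exact: mG.
  rewrite (_ : [set z | _] = g @^-1` `]-oo, k.+1%:R^-1]%classic).
    by rewrite -[X in measurable X]setTI; exact: mg.
  apply/seteqP; split => z /=; rewrite in_itv /=; first exact.
  by move=> h _ _.
apply/seteqP; split => z /= nc h; apply: nc.
  by move=> k; have [m _ hm] := h k I; exists m => i j; exact: (hm i I j I).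
by move=> k _; have [m hm] := h k; exists m => // i _ j _; exact: hm.
Qed.

End measurability.

(** * The exceptional set is null *)

Section null_set.
Context {R : realType} (d : nat) (H : hilbertType R) (M : hilbert_module d H).
Variables (n : nat) (e : 'I_n -> H).
Implicit Types (z : Cn R d).

Lemma radial_zrot th z :
  radial (zrot (cos th) (sin th) z) = zrot (cos th) (sin th) (radial z).
Proof.
rewrite /radial cnorm_zrot ?cos2Dsin2 //; apply/eq_from_tnth => k.
by rewrite !tnth_mktuple /prot /=; congr pair; ring.
Qed.

Lemma cnorm_radial z : cnorm z != 0 -> cnorm (radial z) = 1.
Proof. by move=> z0; rewrite /radial cnorm_rscale ?invr_ge0 ?cnorm_ge0 // mulVf. Qed.

Lemma radialK z : radial (radial z) = radial z.
Proof.
have [z0|z0] := eqVneq (cnorm z) 0; last by rewrite radial_id // cnorm_radial.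
apply/eq_from_tnth => k.
by rewrite /radial z0 invr0 !tnth_mktuple /= !mul0r !mulr0.
Qed.

(** The extension is constant on rays, so that null sets for the cone measure can be tested by
    volume. *)
Definition total_energy (r : R) z := \sum_i energy M (radial z) (e i) r.

Lemma left_cauchy_sum (g : 'I_n -> R -> R) : (forall i, left_cauchy (g i)) ->
  left_cauchy (fun r => \sum_i g i r).
Proof.
move=> gc; apply/left_cauchyP; apply/cvg_ex.
exists (\sum_i lim (g i r @[r --> 1^'-])).
apply: cvg_big => [|i _]; first exact: add_continuous.
by move/left_cauchyP : (gc i).
Qed.

(** The origin is left out because [energy_slice] is applied at [radial z], which must lie on the
    sphere. *)
Definition bad_set : set (Cn R d) :=
  [set z | cnorm z <> 0 /\ ~ rat_cauchy (total_energy ^~ z)].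

Lemma measurable_bad_set : measurable bad_set.
Proof.
have -> : bad_set = (@cnorm R d @^-1` ~` [set 0]) `&` [set z | ~ rat_cauchy (total_energy ^~ z)].
  by apply/seteqP; split.
apply: measurableI.
  rewrite -[X in measurable X]setTI; apply: measurable_cnorm => //.
  by apply: measurableC; exact: measurable_set1.
apply: measurable_rat_cauchy => r r01; apply: measurable_sum => i.
exact: measurable_energy.
Qed.

Lemma volume_bad_set : volume R d bad_set = 0%E.
Proof.
apply: volume_slice0; first exact: measurable_bad_set.
move=> z; have [z0|z0] := eqVneq (cnorm z) 0.
  apply: (@negligibleS _ _ _ _ set0); last exact: negligible_set0.
  by move=> th /= [_ [+ _]]; rewrite cnorm_zrot ?cos2Dsin2.
(* Indexed by natural numbers to fit countable unions; [F k] is empty for [k >= n]. *)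
pose F (k : nat) := [set th : R | exists i : 'I_n, k = i /\ (-1 <= th <= 1 /\
  ~ left_cauchy (energy M (zrot (cos th) (sin th) (radial z)) (e i)))].
apply: (@negligibleS _ _ _ (@lebesgue_measure R) (\bigcup_k F k)).
  move=> th [thb [_ nc]]; apply: contrapT => nF; apply: nc; apply: left_rat_cauchy.
  rewrite /total_energy radial_zrot; apply: left_cauchy_sum => i.
  by apply: contrapT => nc; apply: nF; exists i => //; exists i.
apply: negligible_bigcup => k.
have [kn|kn] := ltnP k n.
  apply: negligibleS (energy_slice M (cnorm_radial z0) (e (Ordinal kn))) => th /= [i [ki]].
  by have -> : i = Ordinal kn by exact/val_inj.
apply: (@negligibleS _ _ _ _ set0); last exact: negligible_set0.
by move=> th [i [ki _]]; have := ltn_ord i; rewrite -ki ltnNge kn.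
Qed.

(** [bad_set] is a cone: if [radial z] lies in it then so does [z]. The cone measure of [bad_set] is
    thus at most a multiple of its volume. *)
Lemma sphere_measure_bad_set : @sphere_measure R d bad_set = 0%E.
Proof.
rewrite /sphere_measure /mscale /= /cone_measure /pushforward /mrestr.
apply/eqP; rewrite mule_eq0; apply/orP; right; apply/eqP.
have mr : measurable (@radial R d @^-1` bad_set).
  by rewrite -[X in measurable X]setTI; apply: measurable_radial => //; exact: measurable_bad_set.
apply: (subset_measure0 _ measurable_bad_set _ volume_bad_set).
  by apply: measurableI => //; exact: measurable_unit_ball.
move=> z [/= [r0 nc] _]; split.
  by move=> z0; apply: r0; rewrite /radial cnorm_rscale ?invr_ge0 ?cnorm_ge0 // z0 mulr0.
by move=> c; apply: nc; move: c; rewrite /total_energy radialK.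
Qed.

Lemma total_energy_cvg z : cnorm z = 1 -> ~ bad_set z ->
  cvg (total_energy r z @[r --> 1^'-]).
Proof.
move=> z1 nb; apply/left_cauchyP; apply: rat_left_cauchy.
  move=> r r01; apply: cvg_big => [|i _]; first exact: add_continuous.
  by apply: energy_continuous => //; rewrite cnorm_radial_le.
by apply: contrapT => nc; apply: nb; split => //; rewrite z1; apply/eqP/oner_neq0.
Qed.

End null_set.

Lemma cvg_real_complex {R : realType} (T : Type) (F : set_system T) {FF : Filter F}
    (f : T -> R) (l : R) :
  f t @[t --> F] --> l -> ((f t)%:C : R[i]^o) @[t --> F] --> (l%:C : R[i]^o).
Proof.
move=> /cvgrPdist_le fl; apply/cvgrPdist_le => e e0.
have [e' e'E] : exists e', e = e'%:C by apply/complex_realP; rewrite realE (ltW e0).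
have e'0 : 0 < e' by rewrite e'E ltcR in e0.
apply: filterS (fl _ e'0) => t h.
by rewrite e'E -rmorphB normc_def /= expr0n addr0 sqrtr_sqr lecR.
Qed.

Theorem theoremA (R : realType) (d : nat) (d_gt0 : (0 < d)%N)
    (H : hilbertType R) (M : hilbert_module d H) (M_finite_rank : finite_rank M) :
  {ae @sphere_measure R d, forall z, unit_sphere z ->
    cvg (curvature_fun M z r @[r --> 1^'-]) /\ 0 <= K0 M z <= (rank M)%:R}.
Proof.
have [n [e eV]] := M_finite_rank.
have rkE : rank M = n by exact: dimension_onb eV.
(* The basis is fixed before [z], so one null set serves all points; on the sphere [radial z] is [z]
   and [curvature_fun] becomes [total_energy]. *)
exists (bad_set M e); split; [exact: measurable_bad_set|exact: sphere_measure_bad_set|].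
move=> z /=; apply: contra_notP => nb z1.
have /cvg_ex [l gl] := total_energy_cvg z1 nb.
have near01 : \forall r \near (1 : R)^'-, 0 <= r < 1.
  by near=> r; apply/andP; split; near: r; [apply: nbhs_left_ge|exact: nbhs_left_lt].
have cl : curvature_fun M z r @[r --> 1^'-] --> (l%:C : R[i]^o).
  apply: cvg_trans (cvg_real_complex gl); apply: near_eq_cvg.
  apply: filterS near01 => r r01.
  by rewrite (curvature_funE eV z1 r01) /total_energy radial_id.
split; first by apply/cvg_ex; exists l%:C.
rewrite /K0 (cvg_lim _ cl); last exact: norm_hausdorff.
rewrite ler0c rkE -(rmorph_nat (real_complex R)) lecR; apply/andP; split.
  apply: (cvgr_to_ge gl); apply: filterS near01 => r r01.
  by apply: sumr_ge0 => i _; exact: energy_ge0.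
apply: (cvgr_to_le gl); apply: filterS near01 => r r01.
have -> : n%:R = \sum_(i < n) (1 : R) by rewrite sumr_const card_ord.
apply: ler_sum => i _; rewrite radial_id //.
apply: le_trans (energy_le _ _ z1 r01) _.
have [_ eo _] := eV.
by rewrite nm_sqr /rdot eo eqxx.
Unshelve. all: by end_near. Qed.
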